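(* Let $Q_8=\{\pm1,\pm i,\pm j,\pm k\}$ be the quaternion group of order $8$. Then $\mathcal{C}(Q_8)$ has the homotopy type of a wedge of three circles, and hence $\pi_1(\mathcal{C}(Q_8))\cong\mathbb{Z}*\mathbb{Z}*\mathbb{Z}$ (the free group of rank three).
   Context: For a finite group $G$, the coset poset $\mathcal{C}(G)$ is the set of all left cosets $xH$ of all proper subgroups $H<G$ (including cosets of the trivial subgroup), ordered by inclusion. Topological statements about a poset refer to the geometric realization of its order complex (the simplicial complex whose simplices are the finite chains). *)

(* Defs.v *)
From HB Require Import structures.
From mathcomp Require Import all_boot all_order all_fingroup all_algebra.
From mathcomp Require Import extremal generic_quotient.
From mathcomp Require Import all_classical reals topology normedtype homotopy.
From mathcomp Require Import lra.

Set Implicit Arguments.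
Unset Strict Implicit.
Unset Printing Implicit Defensive.

Import Order.TTheory Order.DefaultSetSubsetOrder GRing.Theory Num.Theory numFieldNormedType.Exports.

Local Open Scope classical_set_scope.
Local Open Scope ring_scope.
Local Open Scope quotient_scope.

Definition is_chain d (P : finPOrderType d) (s : {set P}) : bool :=
  [forall x in s, forall y in s, (x >=< y)%O].

(* Simplices are nonempty, so the empty chain is left out. *)
Definition order_complex d (P : finPOrderType d) : {set {set P}} :=
  [set s : {set P} | (s != finset.set0) && is_chain s]%SET.

(* The points of the realization are the barycentric coordinates supported on
   a simplex.  There are finitely many vertices, so the weak topology of the
   complex is the subspace topology inherited from R^V. *)
Definition realization (R : realType) (V : finType) (K : {set {set V}}) :
    set {ptws V -> R} :=
  [set t | [/\ forall v, 0 <= t v, \sum_v t v = 1 &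
            [set v | t v != 0]%SET \in K]].

Definition poset_space (R : realType) d (P : finPOrderType d) :
  topologicalType := set_type (@realization R P (order_complex P)).

Definition is_proper_coset (gT : finGroupType) (G : {group gT}) :
    pred {set gT} :=
  fun A => [exists H : {group gT}, (H \proper G) && (A \in lcosets H G)].

Record coset_poset (gT : finGroupType) (G : {group gT}) := CosetPoset {
  coset_poset_val : {set gT};
  coset_poset_valP : is_proper_coset G coset_poset_val }.

Section CosetPosetInstances.
Variables (gT : finGroupType) (G : {group gT}).
HB.instance Definition _ := [isSub for @coset_poset_val gT G].
HB.instance Definition _ := [Finite of coset_poset G by <:].
HB.instance Definition _ := [SubChoice_isSubPOrder of coset_poset G by <:
  with Order.SetSubsetOrder.subset_display].

Lemma coset_poset_leE (a b : coset_poset G) :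
  (a <= b)%O = (coset_poset_val a \subset coset_poset_val b).
Proof. by []. Qed.
End CosetPosetInstances.

Definition unit_interval (R : realType) : Type :=
  set_type (`[0, 1]%classic : set R).

Section UnitInterval.
Variable R : realType.
Local Notation I := (unit_interval R).

HB.instance Definition _ := Topological.on I.

Definition coord (t : I) : R := sval t.
Arguments coord : simpl never.

Lemma clamp_subproof (r : R) :
  Num.min 1 (Num.max 0 r) \in (`[0, 1]%classic : set R).
Proof.
apply/mem_set; rewrite /= in_itv /= le_min ler01 ge_min lexx /=.
by rewrite le_max lexx.
Qed.

(* The retraction of the real line onto [0, 1]. *)
Definition clamp (r : R) : I :=
  exist (fun x : R => x \in (`[0, 1]%classic : set R)) _ (clamp_subproof r).
Arguments clamp : simpl never.

Lemma coord_clamp r : coord (clamp r) = Num.min 1 (Num.max 0 r).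
Proof. by []. Qed.

Lemma coord_inj : injective coord.
Proof. exact: val_inj. Qed.

Lemma coord_ge0 (t : I) : 0 <= coord t.
Proof. by have /set_mem := svalP t; rewrite /= in_itv => /andP[]. Qed.

Lemma coord_le1 (t : I) : coord t <= 1.
Proof. by have /set_mem := svalP t; rewrite /= in_itv => /andP[]. Qed.

Lemma coordK (t : I) : clamp (coord t) = t.
Proof.
apply: coord_inj; rewrite coord_clamp.
by rewrite (max_idPr (coord_ge0 t)) (min_idPr (coord_le1 t)).
Qed.

Lemma coord_clamp_id r : 0 <= r <= 1 -> coord (clamp r) = r.
Proof. by case/andP=> r0 r1; rewrite coord_clamp (max_idPr r0) (min_idPr r1). Qed.

Lemma zero_one_neq_subproof : clamp 0 != clamp 1.
Proof.
apply/eqP => /(congr1 coord); rewrite !coord_clamp_id ?lexx ?ler01 //.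
by move/esym/eqP; rewrite oner_eq0.
Qed.

HB.instance Definition _ := isBiPointed.Build I zero_one_neq_subproof.

Lemma coord0 : coord zero = 0.
Proof. by rewrite coord_clamp_id ?lexx ?ler01. Qed.

Lemma coord1 : coord one = 1.
Proof. by rewrite coord_clamp_id ?lexx ?ler01. Qed.

Lemma clamp_le0 r : r <= 0 -> clamp r = zero.
Proof.
by move=> r0; apply: coord_inj; rewrite coord0 coord_clamp (max_idPl r0) (min_idPr ler01).
Qed.

Lemma clamp_ge1 r : 1 <= r -> clamp r = one.
Proof.
move=> r1; apply: coord_inj.
by rewrite coord1 coord_clamp (max_idPr (le_trans ler01 r1)) (min_idPl r1).
Qed.

Lemma continuous_coord : continuous coord.
Proof. exact: initial_continuous. Qed.

Lemma continuous_clamp : continuous clamp.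
Proof.
apply: continuous_comp_initial => r.
apply: (@continuous_min R R (fun=> 1) (fun r => Num.max 0 r)) => //; first exact: cvg_cst.
apply: (@continuous_max R R (fun=> 0) id) => //; exact: cvg_cst.
Qed.

Lemma continuous_comp_all (X Y Z : topologicalType) (f : X -> Y) (g : Y -> Z) :
  continuous g -> continuous f -> continuous (fun x => g (f x)).
Proof. by move=> cg cf x; apply: (continuous_comp (cf x)); exact: cg. Qed.

Lemma continuous_pair (X Y Z : topologicalType) (f : X -> Y) (g : X -> Z) :
  continuous f -> continuous g -> continuous (fun x => (f x, g x)).
Proof. by move=> cf cg x; apply: cvg_pair; [exact: cf | exact: cg]. Qed.

Lemma continuous_id_all (X : topologicalType) : continuous (fun x : X => x).
Proof. by move=> x; exact: cvg_id. Qed.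

Lemma continuous_cst_all (X Y : topologicalType) (c : Y) :
  continuous (fun _ : X => c).
Proof. by move=> x; exact: cvg_cst. Qed.

Lemma continuous_fst_all (X Y : topologicalType) : continuous (@fst X Y).
Proof. by move=> x; exact: cvg_fst. Qed.

Lemma continuous_snd_all (X Y : topologicalType) : continuous (@snd X Y).
Proof. by move=> x; exact: cvg_snd. Qed.

Lemma continuousD_all (X : topologicalType) (f g : X -> R) :
  continuous f -> continuous g -> continuous (fun x => f x + g x).
Proof. by move=> cf cg x; exact: (cvgD (cf x) (cg x)). Qed.

Lemma continuousB_all (X : topologicalType) (f g : X -> R) :
  continuous f -> continuous g -> continuous (fun x => f x - g x).
Proof. by move=> cf cg x; exact: (cvgB (cf x) (cg x)). Qed.

Lemma continuousM_all (X : topologicalType) (f g : X -> R) :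
  continuous f -> continuous g -> continuous (fun x => f x * g x).
Proof. by move=> cf cg x; exact: (cvgM (cf x) (cg x)). Qed.

Lemma continuous_min_all (X : topologicalType) (f g : X -> R) :
  continuous f -> continuous g -> continuous (fun x => Num.min (f x) (g x)).
Proof. by move=> cf cg x; exact: (@continuous_min R X f g x (cf x) (cg x)). Qed.

Lemma continuous_paste (X Y : topologicalType) (u : X -> R) (f g : X -> Y) :
  continuous u -> continuous f -> continuous g ->
  (forall x, u x = 0 -> f x = g x) ->
  continuous (fun x => if u x <= 0 then f x else g x).
Proof.
move=> cu /continuous_closedP cf /continuous_closedP cg fg.
apply/continuous_closedP => A cA.
have -> : (fun x => if u x <= 0 then f x else g x) @^-1` A =
    ((u @^-1` [set r | r <= 0]) `&` (f @^-1` A)) `|`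
    ((u @^-1` [set r | 0 <= r]) `&` (g @^-1` A)).
  rewrite eqEsubset; split => x /=.
    by case: ifPn => [u0 fA|]; [left | rewrite -ltNge => /ltW; right].
  case=> -[u0 hA]; first by rewrite u0.
  by case: ifPn => // u0'; rewrite fg //; apply/le_anti/andP.
move/continuous_closedP: cu => cu.
by apply: closedU; apply: closedI; (try exact: cf); (try exact: cg); apply: cu;
  [exact: closed_le | exact: closed_ge].
Qed.

End UnitInterval.

Definition homotopic (R : realType) (X Y : topologicalType) (f g : X -> Y) :
    Prop :=
  exists H : X * unit_interval R -> Y,
    [/\ continuous H, forall x, H (x, zero) = f x & forall x, H (x, one) = g x].

Definition homotopy_equivalent (R : realType) (X Y : topologicalType) : Prop :=
  exists (f : X -> Y) (g : Y -> X),
    [/\ continuous f, continuous g,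
        homotopic R (g \o f) idfun & homotopic R (f \o g) idfun].

Definition path_homotopic (R : realType) (X : topologicalType) (x y : X)
    (p q : {path (unit_interval R) from x to y}) : Prop :=
  exists H : unit_interval R * unit_interval R -> X,
    [/\ continuous H,
        forall s, H (s, zero) = p s, forall s, H (s, one) = q s,
        forall t, H (zero, t) = x & forall t, H (one, t) = y].

Section PathOperations.
Variables (R : realType) (X : topologicalType).
Local Notation I := (unit_interval R).
Implicit Types x y z : X.

Definition concat_fun x y z (p : {path I from x to y})
    (q : {path I from y to z}) (s : I) : X :=
  if coord s - 2^-1 <= 0 then p (clamp (2 * coord s))
  else q (clamp (2 * coord s - 1)).

Lemma continuous_coord_comp (Z : topologicalType) (u : Z -> I) :
  continuous u -> continuous (fun c => coord (u c)).
Proof. exact: (continuous_comp_all (@continuous_coord R)). Qed.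

Lemma continuous_clamp_comp (Z : topologicalType) (u : Z -> R) :
  continuous u -> continuous (fun c => clamp (u c)).
Proof. exact: (continuous_comp_all (@continuous_clamp R)). Qed.

Lemma continuous_half (Z : topologicalType) (u : Z -> I) :
  continuous u -> continuous (fun c => coord (u c) - 2^-1).
Proof.
move=> cu; apply: continuousB_all; last exact: continuous_cst_all.
exact: continuous_coord_comp.
Qed.

Lemma continuous_first_half (Z : topologicalType) (u : Z -> I) :
  continuous u -> continuous (fun c => clamp (2 * coord (u c))).
Proof.
move=> cu; apply: continuous_clamp_comp; apply: continuousM_all.
  exact: continuous_cst_all.
exact: continuous_coord_comp.
Qed.

Lemma continuous_second_half (Z : topologicalType) (u : Z -> I) :
  continuous u -> continuous (fun c => clamp (2 * coord (u c) - 1)).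
Proof.
move=> cu; apply: continuous_clamp_comp; apply: continuousB_all.
  apply: continuousM_all; first exact: continuous_cst_all.
  exact: continuous_coord_comp.
exact: continuous_cst_all.
Qed.

Lemma halfE (r : R) : r - 2^-1 = 0 -> 2 * r = 1 /\ 2 * r - 1 = 0.
Proof. by move=> h; split; lra. Qed.

Lemma continuous_concat x y z (p : {path I from x to y})
  (q : {path I from y to z}) : continuous (concat_fun p q).
Proof.
apply: continuous_paste.
- by apply: continuous_half; exact: continuous_id_all.
- apply: continuous_comp_all; first exact: cts_fun.
  by apply: continuous_first_half; exact: continuous_id_all.
- apply: continuous_comp_all; first exact: cts_fun.
  by apply: continuous_second_half; exact: continuous_id_all.
- move=> s /halfE[-> ->].
  by rewrite clamp_ge1 // clamp_le0 // path_one path_zero.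
Qed.

Lemma concat_zero x y z (p : {path I from x to y}) (q : {path I from y to z}) :
  concat_fun p q zero = x.
Proof.
rewrite /concat_fun coord0 ifT; last lra.
by rewrite clamp_le0 ?mulr0 // path_zero.
Qed.

Lemma concat_one x y z (p : {path I from x to y}) (q : {path I from y to z}) :
  concat_fun p q one = z.
Proof.
rewrite /concat_fun coord1 ifF; last by apply/negbTE; rewrite -ltNge; lra.
by rewrite clamp_ge1 ?path_one //; lra.
Qed.

Definition concat x y z (p : {path I from x to y})
    (q : {path I from y to z}) : {path I from x to z} :=
  mk_path (@continuous_concat x y z p q) (concat_zero p q) (concat_one p q).

Lemma concat_le x y z (p : {path I from x to y}) (q : {path I from y to z}) s :
  coord s <= 2^-1 -> concat p q s = p (clamp (2 * coord s)).
Proof. by move=> s2; rewrite /= /mk_path /concat_fun ifT //; lra. Qed.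

Lemma concat_ge x y z (p : {path I from x to y}) (q : {path I from y to z}) s :
  2^-1 <= coord s -> concat p q s = q (clamp (2 * coord s - 1)).
Proof.
move=> s2; rewrite /= /mk_path /concat_fun; case: ifPn => // s2'.
by rewrite clamp_ge1 ?clamp_le0 ?path_one ?path_zero //; lra.
Qed.

Definition flip (s : I) : I := clamp (1 - coord s).

Lemma continuous_flip : continuous flip.
Proof.
apply: continuous_clamp_comp; apply: continuousB_all.
  exact: continuous_cst_all.
exact: continuous_coord.
Qed.

Lemma continuous_reverse x y (p : {path I from x to y}) :
  continuous (p \o flip).
Proof.
by apply: continuous_comp_all; [exact: cts_fun | exact: continuous_flip].
Qed.

Lemma reverse_zero x y (p : {path I from x to y}) : (p \o flip) zero = y.
Proof. by rewrite /= /flip coord0 subr0 clamp_ge1 // path_one. Qed.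

Lemma reverse_one x y (p : {path I from x to y}) : (p \o flip) one = x.
Proof. by rewrite /= /flip coord1 subrr clamp_le0 // path_zero. Qed.

Definition reverse x y (p : {path I from x to y}) : {path I from y to x} :=
  mk_path (@continuous_reverse x y p) (reverse_zero p) (reverse_one p).

Definition const_path x : {path I from x to x} := cst x.

Arguments coord : simpl never.
Arguments clamp : simpl never.
Arguments flip : simpl never.

Lemma reparam_homotopic x y (p q : {path I from x to y}) (f : I -> X)
    (a b : I -> I) :
  continuous f -> continuous a -> continuous b ->
  a zero = b zero -> a one = b one -> p =1 f \o a -> q =1 f \o b ->
  path_homotopic p q.
Proof.
move=> cf ca cb ab0 ab1 pf qf.
pose H (st : I * I) : X :=
  f (clamp (coord (a st.1) + coord st.2 * (coord (b st.1) - coord (a st.1)))).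
have cc (u : I -> I) : continuous u ->
    continuous (fun st : I * I => coord (u st.1)).
  move=> cu; apply: continuous_coord_comp.
  by apply: continuous_comp_all => //; exact: continuous_fst_all.
exists H; split.
- apply: continuous_comp_all => //.
  apply: continuous_clamp_comp; apply: continuousD_all; first exact: (cc a).
  apply: continuousM_all.
    by apply: continuous_coord_comp; exact: continuous_snd_all.
  by apply: continuousB_all; [exact: (cc b) | exact: (cc a)].
- by move=> s; rewrite /H /= coord0 mul0r addr0 coordK pf.
- by move=> s; rewrite /H /= coord1 mul1r subrKC coordK qf.
- move=> t; rewrite /H /= ab0 subrr mulr0 addr0 coordK.
  by have := qf zero; rewrite path_zero.
- move=> t; rewrite /H /= ab1 subrr mulr0 addr0 coordK.
  by have := qf one; rewrite path_one.
Qed.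

Lemma path_homotopic_refl x y (p : {path I from x to y}) : path_homotopic p p.
Proof.
by apply: (@reparam_homotopic _ _ p p p id id) => //;
  [exact: cts_fun | exact: continuous_id_all | exact: continuous_id_all].
Qed.

Lemma path_homotopic_sym x y (p q : {path I from x to y}) :
  path_homotopic p q -> path_homotopic q p.
Proof.
case=> H [cH Hp Hq Hx Hy]; exists (fun st => H (st.1, flip st.2)); split.
- apply: continuous_comp_all => //; apply: continuous_pair.
    exact: continuous_fst_all.
  apply: continuous_comp_all; first exact: continuous_flip.
  exact: continuous_snd_all.
- by move=> s; rewrite /= /flip coord0 subr0 clamp_ge1.
- by move=> s; rewrite /= /flip coord1 subrr clamp_le0.
- by move=> t; exact: Hx.
- by move=> t; exact: Hy.
Qed.

Lemma path_homotopic_trans x y (p q r : {path I from x to y}) :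
  path_homotopic p q -> path_homotopic q r -> path_homotopic p r.
Proof.
case=> H [cH Hp Hq Hx Hy] [K [cK Kq Kr Kx Ky]].
exists (fun st => if coord st.2 - 2^-1 <= 0 then H (st.1, clamp (2 * coord st.2))
  else K (st.1, clamp (2 * coord st.2 - 1))); split.
- have c1 : continuous (@fst I I) by exact: continuous_fst_all.
  have c2 : continuous (@snd I I) by exact: continuous_snd_all.
  apply: continuous_paste.
  + exact: continuous_half.
  + apply: continuous_comp_all => //; apply: continuous_pair => //.
    exact: continuous_first_half.
  + apply: continuous_comp_all => //; apply: continuous_pair => //.
    exact: continuous_second_half.
  + move=> st /halfE[-> ->].
    by rewrite clamp_ge1 // clamp_le0 // Hq Kq.
- move=> s /=; rewrite coord0 ifT; last lra.
  by rewrite clamp_le0 ?mulr0 // Hp.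
- move=> s /=; rewrite coord1 ifF; last by apply/negbTE; rewrite -ltNge; lra.
  by rewrite clamp_ge1 ?Kr //; lra.
- by move=> t /=; rewrite Hx Kx; case: ifP.
- by move=> t /=; rewrite Hy Ky; case: ifP.
Qed.

Lemma concat_homotopic x y z (p p' : {path I from x to y})
    (q q' : {path I from y to z}) :
  path_homotopic p p' -> path_homotopic q q' ->
  path_homotopic (concat p q) (concat p' q').
Proof.
case=> H [cH Hp Hq Hx Hy] [K [cK Kq Kr Kx Ky]].
exists (fun st => if coord st.1 - 2^-1 <= 0 then H (clamp (2 * coord st.1), st.2)
  else K (clamp (2 * coord st.1 - 1), st.2)); split.
- have c1 : continuous (@fst I I) by exact: continuous_fst_all.
  have c2 : continuous (@snd I I) by exact: continuous_snd_all.
  apply: continuous_paste.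
  + exact: continuous_half.
  + apply: continuous_comp_all => //; apply: continuous_pair => //.
    exact: continuous_first_half.
  + apply: continuous_comp_all => //; apply: continuous_pair => //.
    exact: continuous_second_half.
  + move=> st /halfE[-> ->].
    by rewrite clamp_ge1 // clamp_le0 // Hy Kx.
- by move=> s; rewrite /= Hp Kq.
- by move=> s; rewrite /= Hq Kr.
- move=> t /=; rewrite coord0 ifT; last lra.
  by rewrite clamp_le0 ?mulr0 // Hx.
- move=> t /=; rewrite coord1 ifF; last by apply/negbTE; rewrite -ltNge; lra.
  by rewrite clamp_ge1 ?Ky //; lra.
Qed.

Lemma reverse_homotopic x y (p q : {path I from x to y}) :
  path_homotopic p q -> path_homotopic (reverse p) (reverse q).
Proof.
case=> H [cH Hp Hq Hx Hy]; exists (fun st => H (flip st.1, st.2)); split.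
- apply: continuous_comp_all => //; apply: continuous_pair.
    apply: continuous_comp_all; first exact: continuous_flip.
    exact: continuous_fst_all.
  exact: continuous_snd_all.
- by move=> s; rewrite /= Hp.
- by move=> s; rewrite /= Hq.
- by move=> t; rewrite /= /flip coord0 subr0 clamp_ge1.
- by move=> t; rewrite /= /flip coord1 subrr clamp_le0.
Qed.

Lemma concatA_homotopic x y z w (p : {path I from x to y})
    (q : {path I from y to z}) (r : {path I from z to w}) :
  path_homotopic (concat p (concat q r)) (concat (concat p q) r).
Proof.
pose m (r : R) := Num.min (2 * r) (Num.min (r + 4^-1) (2^-1 * (r + 1))).
pose b (s : I) := clamp (m (coord s)).
have mlo (u : R) : u <= 4^-1 -> m u = 2 * u.
  by move=> ?; rewrite /m !minEle; do ?[case: ifPn; rewrite -?ltNge]; lra.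
have mmi (u : R) : 4^-1 <= u -> u <= 2^-1 -> m u = u + 4^-1.
  by move=> ? ?; rewrite /m !minEle; do ?[case: ifPn; rewrite -?ltNge]; lra.
have mhi (u : R) : 2^-1 <= u -> m u = 2^-1 * (u + 1).
  by move=> ?; rewrite /m !minEle; do ?[case: ifPn; rewrite -?ltNge]; lra.
apply: (@reparam_homotopic _ _ _ _ (concat p (concat q r)) id b) => //;
  first exact: continuous_concat.
- exact: continuous_id_all.
- have cM (c : R) (f : I -> R) : continuous f -> continuous (fun s => c * f s).
    by apply: continuousM_all; exact: continuous_cst_all.
  have cD (c : R) (f : I -> R) : continuous f -> continuous (fun s => f s + c).
    by move=> cf; apply: continuousD_all => //; exact: continuous_cst_all.
  have cc := @continuous_coord R.
  apply: continuous_clamp_comp; apply: continuous_min_all; first exact: cM.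
  apply: continuous_min_all; first exact: cD.
  by apply: cM; exact: cD.
- by rewrite /b coord0 mlo ?mulr0 ?clamp_le0 //; lra.
- by rewrite /b coord1 mhi ?clamp_ge1 //; lra.
move=> s; have s0 := coord_ge0 s; have s1 := coord_le1 s.
have [s4|s4] := leP (coord s) 4^-1.
  have e1 : coord (clamp (2 * coord s)) = 2 * coord s.
    by rewrite coord_clamp_id; lra.
  by rewrite /= concat_le ?concat_le /b ?mlo ?e1 //; lra.
have [s2|s2] := leP (coord s) 2^-1.
  have e1 : coord (clamp (2 * coord s)) = 2 * coord s.
    by rewrite coord_clamp_id; lra.
  have e2 : coord (b s) = coord s + 4^-1.
    by rewrite /b mmi ?coord_clamp_id; lra.
  have e3 : coord (clamp (2 * (coord s + 4^-1) - 1)) = 2 * coord s - 2^-1.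
    by rewrite coord_clamp_id; lra.
  rewrite /= (concat_le _ _ s2) concat_ge ?e1; last lra.
  rewrite concat_ge ?concat_le ?e2 ?e3; [|lra..].
  by congr (q (clamp _)); lra.
have e2 : coord (b s) = 2^-1 * (coord s + 1).
  by rewrite /b mhi ?coord_clamp_id; lra.
have e3 : coord (clamp (2 * (2^-1 * (coord s + 1)) - 1)) = coord s.
  by rewrite coord_clamp_id; lra.
rewrite /= concat_ge; last lra.
by rewrite concat_ge ?concat_ge ?e2 ?e3 //; lra.
Qed.

Lemma concat1_homotopic x y (p : {path I from x to y}) :
  path_homotopic (concat (const_path x) p) p.
Proof.
apply: (@reparam_homotopic _ _ _ _ p (fun s => clamp (2 * coord s - 1)) id) => //.
- exact: cts_fun.
- by apply: continuous_second_half; exact: continuous_id_all.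
- exact: continuous_id_all.
- by rewrite coord0 clamp_le0 //; lra.
- by rewrite coord1 clamp_ge1 //; lra.
move=> s; have [s2|/ltW s2] := leP (coord s) 2^-1; last exact: concat_ge.
by rewrite concat_le //= [clamp (_ - _)]clamp_le0 ?path_zero //; lra.
Qed.

Lemma concatp1_homotopic x y (p : {path I from x to y}) :
  path_homotopic (concat p (const_path y)) p.
Proof.
apply: (@reparam_homotopic _ _ _ _ p (fun s => clamp (2 * coord s)) id) => //.
- exact: cts_fun.
- by apply: continuous_first_half; exact: continuous_id_all.
- exact: continuous_id_all.
- by rewrite coord0 clamp_le0 //; lra.
- by rewrite coord1 clamp_ge1 //; lra.
move=> s; have [s2|/ltW s2] := leP (coord s) 2^-1; first exact: concat_le.
by rewrite concat_ge //= [clamp (2 * _)]clamp_ge1 ?path_one //; lra.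
Qed.

Lemma concat_reverse_homotopic x y (p : {path I from x to y}) :
  path_homotopic (concat p (reverse p)) (const_path x).
Proof.
pose a (s : I) := clamp (Num.min (2 * coord s) (2 - 2 * coord s)).
apply: (@reparam_homotopic _ _ _ _ p a (fun=> zero)) => //.
- exact: cts_fun.
- have c2 : continuous (fun s : I => 2 * coord s).
    apply: continuousM_all; first exact: continuous_cst_all.
    exact: continuous_coord.
  apply: continuous_clamp_comp; apply: continuous_min_all => //.
  by apply: continuousB_all => //; exact: continuous_cst_all.
- exact: continuous_cst_all.
- by rewrite /a clamp_le0 // coord0 ge_min; apply/orP; left; lra.
- by rewrite /a clamp_le0 // coord1 ge_min; apply/orP; right; lra.
- move=> s; have s0 := coord_ge0 s; have s1 := coord_le1 s.
  have [s2|/ltW s2] := leP (coord s) 2^-1.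
    by rewrite concat_le //= /a min_l //; lra.
  rewrite concat_ge //= /mk_path /= /flip /a coord_clamp_id ?min_r; [|lra..].
  by congr (p (clamp _)); lra.
- by move=> s; rewrite /= path_zero.
Qed.

Lemma reverseK x y (p : {path I from x to y}) : reverse (reverse p) =1 p.
Proof.
move=> s; have s0 := coord_ge0 s; have s1 := coord_le1 s.
rewrite /= /mk_path /= /mk_path /= /flip coord_clamp_id; last lra.
by rewrite subKr coordK.
Qed.

End PathOperations.

Section FundamentalGroup.
Variables (R : realType) (X : topologicalType) (x : X).
Local Notation I := (unit_interval R).
Local Notation loop := {path I from x to x}.

Definition loop_rel : rel loop := fun p q => `[< path_homotopic p q >].

Lemma loop_rel_refl : reflexive loop_rel.
Proof. by move=> p; apply/asboolP; exact: path_homotopic_refl. Qed.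

Lemma loop_rel_sym : symmetric loop_rel.
Proof. by move=> p q; apply/asboolP/asboolP; exact: path_homotopic_sym. Qed.

Lemma loop_rel_trans : transitive loop_rel.
Proof.
move=> q p r /asboolP pq /asboolP qr; apply/asboolP.
exact: path_homotopic_trans pq qr.
Qed.

Canonical loop_equiv :=
  EquivRel loop_rel loop_rel_refl loop_rel_sym loop_rel_trans.

Definition pi1 : Type := {eq_quot loop_equiv}.
HB.instance Definition _ := Choice.on pi1.
HB.instance Definition _ := EqQuotient.on pi1.

Definition loop_class (p : loop) : pi1 := \pi_pi1 p.

Lemma loop_classP p q : loop_class p = loop_class q <-> path_homotopic p q.
Proof.
split=> [pq|pq]; first by have /eqmodP := pq; move/asboolP.
by apply/eqmodP; apply/asboolP.
Qed.

Definition pi1_one : pi1 := loop_class (const_path R x).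
Definition pi1_mul (a b : pi1) : pi1 := loop_class (concat (repr a) (repr b)).
Definition pi1_inv (a : pi1) : pi1 := loop_class (reverse (repr a)).

Lemma loop_class_repr (a : pi1) : loop_class (repr a) = a.
Proof. exact: reprK. Qed.

Lemma repr_loop_class p : path_homotopic (repr (loop_class p)) p.
Proof. by apply/loop_classP; rewrite loop_class_repr. Qed.

Lemma loop_class_concat p q :
  pi1_mul (loop_class p) (loop_class q) = loop_class (concat p q).
Proof. by apply/loop_classP/concat_homotopic; exact: repr_loop_class. Qed.

Lemma loop_class_reverse p : pi1_inv (loop_class p) = loop_class (reverse p).
Proof. by apply/loop_classP/reverse_homotopic; exact: repr_loop_class. Qed.

Lemma pi1_mulA : associative pi1_mul.
Proof.
move=> a b c; rewrite -(loop_class_repr a) -(loop_class_repr b).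
rewrite -(loop_class_repr c) !loop_class_concat.
by apply/loop_classP; exact: concatA_homotopic.
Qed.

Lemma pi1_mul1 : left_id pi1_one pi1_mul.
Proof.
move=> a; rewrite -(loop_class_repr a) loop_class_concat.
by apply/loop_classP; exact: concat1_homotopic.
Qed.

Lemma pi1_mulr1 : right_id pi1_one pi1_mul.
Proof.
move=> a; rewrite -(loop_class_repr a) loop_class_concat.
by apply/loop_classP; exact: concatp1_homotopic.
Qed.

Lemma pi1_mulV : right_inverse pi1_one pi1_inv pi1_mul.
Proof.
move=> a; rewrite -(loop_class_repr a) loop_class_reverse loop_class_concat.
by apply/loop_classP; exact: concat_reverse_homotopic.
Qed.

Lemma pi1_Vmul : left_inverse pi1_one pi1_inv pi1_mul.
Proof.
move=> a; rewrite -(loop_class_repr a) loop_class_reverse loop_class_concat.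
apply/loop_classP; have := concat_reverse_homotopic (reverse (repr a)).
by have -> : reverse (reverse (repr a)) = repr a by apply/path_eqP/reverseK.
Qed.

HB.instance Definition _ :=
  isGroup.Build pi1 pi1_mulA pi1_mul1 pi1_mulr1 pi1_Vmul pi1_mulV.

End FundamentalGroup.

Section FreeGroup.
Variable A : choiceType.

(* (a, true) stands for the generator a and (a, false) for its inverse. *)
Definition letter_inv (l : A * bool) : A * bool := (l.1, ~~ l.2).

Definition reduced : pred (seq (A * bool)) :=
  sorted (fun l m => m != letter_inv l).

Record free_group := FreeWord {
  word :> seq (A * bool);
  word_reduced : reduced word }.

HB.instance Definition _ := [isSub for word].
HB.instance Definition _ := [Choice of free_group by <:].

Definition push (l : A * bool) (w : seq (A * bool)) : seq (A * bool) :=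
  if w is m :: w' then if m == letter_inv l then w' else l :: w else [:: l].

Lemma letter_invK : involutive letter_inv.
Proof. by case=> a b; rewrite /letter_inv negbK. Qed.

Lemma push_reduced l w : reduced w -> reduced (push l w).
Proof.
case: w => //= m w mw; case: eqVneq => [_|lm]; first exact: path_sorted mw.
by rewrite /reduced /= lm.
Qed.

Lemma pushK l w : reduced w -> push (letter_inv l) (push l w) = w.
Proof.
case: w => [|m w] /=; first by rewrite letter_invK eqxx.
case: eqVneq => [->|_ _] /=; last by rewrite letter_invK eqxx.
by case: w => [//|n w] /=; rewrite /reduced /= => /andP[/negbTE ->].
Qed.

(* Concatenation followed by free reduction. *)
Definition reduce_cat (v w : seq (A * bool)) := foldr push w v.

Lemma reduce_cat_reduced v w : reduced w -> reduced (reduce_cat v w).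
Proof. by move=> rw; elim: v => //= l v; exact: push_reduced. Qed.

Definition free_one : free_group := @FreeWord [::] isT.

Definition free_mul (v w : free_group) : free_group :=
  FreeWord (reduce_cat_reduced v (word_reduced w)).

Definition word_inv (w : seq (A * bool)) := rev (map letter_inv w).

Lemma word_inv_reduced w : reduced w -> reduced (word_inv w).
Proof.
rewrite /word_inv /reduced rev_sorted sorted_map.
apply: sub_sorted => l m /=; apply: contra => /eqP lm.
by rewrite lm letter_invK.
Qed.

Definition free_inv (w : free_group) : free_group :=
  FreeWord (word_inv_reduced (word_reduced w)).

Lemma reduce_cat_push l v w : reduced v -> reduced w ->
  reduce_cat (push l v) w = push l (reduce_cat v w).
Proof.
case: v => //= m v rv rw; case: eqVneq => [->|//].
by rewrite -{1}(letter_invK l) pushK // reduce_cat_reduced.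
Qed.

Lemma reduce_catA u v w : reduced v -> reduced w ->
  reduce_cat u (reduce_cat v w) = reduce_cat (reduce_cat u v) w.
Proof.
move=> rv rw; elim: u => //= l u ->.
by rewrite reduce_cat_push // reduce_cat_reduced.
Qed.

Lemma reduce_cats0 w : reduced w -> reduce_cat w [::] = w.
Proof.
elim: w => //= l w IH rw; rewrite IH; last exact: path_sorted rw.
by case: w rw {IH} => //= m w; rewrite /reduced /= => /andP[/negbTE ->].
Qed.

Lemma reduce_cat_inv w u : reduced u -> reduce_cat (word_inv w) (reduce_cat w u) = u.
Proof.
elim: w u => // l w IH u ru /=.
rewrite /word_inv /= rev_cons /reduce_cat foldr_rcons pushK.
  exact: IH.
exact: reduce_cat_reduced.
Qed.

Lemma free_mulA : associative free_mul.
Proof.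
by move=> u v w; apply: val_inj; apply: reduce_catA; exact: word_reduced.
Qed.

Lemma free_mul1 : left_id free_one free_mul.
Proof. by move=> w; exact: val_inj. Qed.

Lemma free_mulr1 : right_id free_one free_mul.
Proof. by move=> w; apply/val_inj/reduce_cats0/word_reduced. Qed.

Lemma free_Vmul : left_inverse free_one free_inv free_mul.
Proof.
move=> w; apply: val_inj => /=.
by rewrite -[X in reduce_cat _ X](reduce_cats0 (word_reduced w)) reduce_cat_inv.
Qed.

Lemma free_invK : involutive free_inv.
Proof.
move=> w; apply: val_inj; rewrite /= /word_inv map_rev revK -map_comp.
by rewrite (eq_map letter_invK) map_id.
Qed.

Lemma free_mulV : right_inverse free_one free_inv free_mul.
Proof. by move=> w; rewrite -{1}(free_invK w) free_Vmul. Qed.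

HB.instance Definition _ :=
  isGroup.Build free_group free_mulA free_mul1 free_mulr1 free_Vmul free_mulV.

End FreeGroup.

Definition group_isomorphic (G H : groupType) : Prop :=
  exists f : {multiplicative G -> H}, bijective f.

Definition circle (R : realType) : set (R * R) :=
  [set p | p.1 ^+ 2 + p.2 ^+ 2 = 1].
Arguments circle R : clear implicits.

Lemma circle_base_subproof (R : realType) : ((1 : R), (0 : R)) \in circle R.
Proof. by apply/mem_set; rewrite /circle /= expr1n expr0n addr0. Qed.

Definition circle_base (R : realType) : set_type (circle R) :=
  exist (fun p : R * R => p \in circle R) _ (circle_base_subproof R).

Definition circle_wedge (R : realType) (n : nat) : topologicalType :=
  wedge (fun _ : 'I_n => circle_base R).

(* Main.v *)
Require Import Defs.
From HB Require Import structures.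
From mathcomp Require Import all_boot all_order all_fingroup all_algebra.
From mathcomp Require Import extremal.
From mathcomp Require Import all_classical reals topology homotopy.
From Corelib Require Setoid.
From mathcomp Require Import cyclic center pgroup.
From mathcomp Require Import generic_quotient normedtype realfun ring lra.

Import Defs.

(** A proper subgroup of the quaternion group is trivial or contains the
    centre [Z], because the generator of [Z] is the only involution.  Hence
    adding to a coset the cosets of [Z] that it meets is a closure operator on
    the coset poset.  Its closed elements are the four cosets of [Z] and the
    six unions of two of them (cosets of the cyclic subgroups of order four):
    the vertices and the edges of the complete graph on four vertices.  So the
    coset poset is homotopy equivalent to this graph
    ([poset_graph_equivalent], [coset_poset_Q8_equivalent]).  The graph is a
    wheel with three spokes; collapsing the spokes, which form a spanning
    tree, leaves a wedge of three circles ([wheel_wedge_equivalent]).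

    Maps into a polyhedron are given by nonnegative weights on the vertices,
    up to normalization, and two maps are homotopic along straight segments as
    soon as the two images of each point lie in a common simplex
    ([straight_homotopic]).  All the homotopies between polyhedra that are
    needed have this form, so they reduce to the comparison of supports.

    The fundamental group is computed on the wheel and carried over by
    homotopy invariance ([pi1_homotopy_equivalence]).  A labelling of the
    oriented edges of a simplicial complex that is multiplicative on each
    simplex induces a cocycle on pairs of close points: each point is replaced
    by a vertex at which its barycentric coordinate is large.  The product of
    this cocycle along a fine subdivision of a path is the holonomy of the
    path; it only depends on the homotopy class ([holonomy_homotopic]).  On
    the wheel, labelling the three edges of the rim by the generators of a
    free group and the spokes by 1 gives a morphism from the fundamental group
    to the free group.  Its inverse sends a generator to the loop through the
    corresponding edge of the rim: following a loop step by step shows that it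
    is a product of such loops, read off from its holonomy
    ([loop_class_holonomy], [pi1_wheel]). *)

Set Implicit Arguments.
Unset Strict Implicit.
Unset Printing Implicit Defensive.

Import Order.TTheory GRing.Theory Num.Theory numFieldNormedType.Exports.

Local Open Scope classical_set_scope.
Local Open Scope ring_scope.

Arguments coord : simpl never.
Arguments clamp : simpl never.
Arguments flip : simpl never.

(** * Continuity, homotopies and homotopy equivalences *)

Section Continuity.
Variable R : realType.

Lemma continuous_into_product (J : choiceType) (K : J -> topologicalType)
    (Z : topologicalType) (f : Z -> prod_topology K) :
  (forall j, continuous (fun z => f z j)) -> continuous f.
Proof.
move=> cf z; apply/cvg_sup => j.
move: z; apply/(@continuousP _ (initial_topology (@^~ j))) => A [B oB <-].
have := @open_comp _ _ (fun z => f z j) B; apply => // z _; exact: cf.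
Qed.

Lemma continuous_into_subset (X Z : topologicalType) (A : set X)
    (f : Z -> set_type A) : continuous (set_val \o f) -> continuous f.
Proof. exact: continuous_comp_initial. Qed.

Lemma continuous_set_val (X : topologicalType) (A : set X) :
  continuous (set_val : set_type A -> X).
Proof. exact: initial_continuous. Qed.

Variable Z : topologicalType.
Implicit Types f g : Z -> R.

Lemma continuous_max_all f g :
  continuous f -> continuous g -> continuous (fun z => Num.max (f z) (g z)).
Proof. by move=> cf cg z; exact: (@continuous_max R Z f g z (cf z) (cg z)). Qed.

Lemma continuousN_all f : continuous f -> continuous (fun z => - f z).
Proof. by move=> cf z; exact: (cvgN (cf z)). Qed.

Lemma continuousV_all f :
  (forall z, f z != 0) -> continuous f -> continuous (fun z => (f z)^-1).
Proof. by move=> f0 cf z; exact: (cvgV (f0 z) (cf z)). Qed.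

Lemma continuous_sum_all (J : finType) (P : pred J) (f : J -> Z -> R) :
  (forall j, continuous (f j)) -> continuous (fun z => \sum_(j | P j) f j z).
Proof.
move=> cf; elim: (index_enum J) => [|j r IH].
  rewrite (_ : (fun _ => _) = fun=> 0); first exact: continuous_cst_all.
  by apply/funext => z; rewrite big_nil.
rewrite (_ : (fun _ => _) =
    fun z => (if P j then f j z else 0) + \sum_(j <- r | P j) f j z).
  apply: continuousD_all IH; case: (P j); first exact: cf.
  exact: continuous_cst_all.
by apply/funext => z; rewrite big_cons; case: (P j); rewrite ?add0r.
Qed.

Lemma continuous_prod_all (J : finType) (P : pred J) (f : J -> Z -> R) :
  (forall j, continuous (f j)) -> continuous (fun z => \prod_(j | P j) f j z).
Proof.
move=> cf; elim: (index_enum J) => [|j r IH].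
  rewrite (_ : (fun _ => _) = fun=> 1); first exact: continuous_cst_all.
  by apply/funext => z; rewrite big_nil.
rewrite (_ : (fun _ => _) =
    fun z => (if P j then f j z else 1) * \prod_(j <- r | P j) f j z).
  apply: continuousM_all IH; case: (P j); first exact: cf.
  exact: continuous_cst_all.
by apply/funext => z; rewrite big_cons; case: (P j); rewrite ?mul1r.
Qed.

Lemma continuous_sqrt_all f :
  continuous f -> continuous (fun z => Num.sqrt (f z)).
Proof. by apply: continuous_comp_all; exact: sqrt_continuous. Qed.

End Continuity.

Section Homotopies.
Variable R : realType.
Local Notation I := (unit_interval R).
Implicit Types X Y Z W : topologicalType.

Lemma homotopic_sym X Y (f g : X -> Y) : homotopic R f g -> homotopic R g f.
Proof.
case=> H [cH H0 H1]; exists (fun xt => H (xt.1, flip xt.2)); split.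
- apply: continuous_comp_all => //; apply: continuous_pair.
    exact: continuous_fst_all.
  apply: continuous_comp_all; first exact: continuous_flip.
  exact: continuous_snd_all.
- by move=> x; rewrite /= /flip coord0 subr0 clamp_ge1.
- by move=> x; rewrite /= /flip coord1 subrr clamp_le0.
Qed.

Lemma homotopic_trans X Y (f g h : X -> Y) :
  homotopic R f g -> homotopic R g h -> homotopic R f h.
Proof.
case=> H [cH H0 H1] [K [cK K0 K1]].
exists (fun xt => if coord xt.2 - 2^-1 <= 0 then H (xt.1, clamp (2 * coord xt.2))
  else K (xt.1, clamp (2 * coord xt.2 - 1))); split.
- have c1 : continuous (@fst X I) by exact: continuous_fst_all.
  have c2 : continuous (@snd X I) by exact: continuous_snd_all.
  apply: continuous_paste.
  + exact: continuous_half.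
  + apply: continuous_comp_all => //; apply: continuous_pair => //.
    exact: continuous_first_half.
  + apply: continuous_comp_all => //; apply: continuous_pair => //.
    exact: continuous_second_half.
  + move=> xt /halfE[-> ->].
    by rewrite clamp_ge1 // clamp_le0 // H1 K0.
- move=> x /=; rewrite coord0 ifT; last lra.
  by rewrite clamp_le0 ?mulr0 // H0.
- move=> x /=; rewrite coord1 ifF; last by apply/negbTE; rewrite -ltNge; lra.
  by rewrite clamp_ge1 ?K1 //; lra.
Qed.

Lemma homotopic_comp X Y Z W (f g : Y -> Z) (u : X -> Y) (v : Z -> W) :
  continuous u -> continuous v -> homotopic R f g ->
  homotopic R (v \o f \o u) (v \o g \o u).
Proof.
move=> cu cv [H [cH H0 H1]]; exists (fun xt => v (H (u xt.1, xt.2))); split.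
- apply: continuous_comp_all => //; apply: continuous_comp_all => //.
  apply: continuous_pair; last exact: continuous_snd_all.
  by apply: continuous_comp_all => //; exact: continuous_fst_all.
- by move=> x /=; rewrite H0.
- by move=> x /=; rewrite H1.
Qed.

Lemma homotopy_equivalent_trans X Y Z :
  homotopy_equivalent R X Y -> homotopy_equivalent R Y Z ->
  homotopy_equivalent R X Z.
Proof.
case=> f [g [cf cg gf fg]] [f' [g' [cf' cg' gf' fg']]].
exists (f' \o f), (g \o g'); split.
- exact: continuous_comp_all.
- exact: continuous_comp_all.
- exact: homotopic_trans (homotopic_comp cf cg gf') gf.
- exact: homotopic_trans (homotopic_comp cg' cf' fg) fg'.
Qed.

(** Both corner paths of the square [I * I] join the same two opposite
    vertices, and the square is convex. *)
Lemma square_homotopic X (S : I * I -> X) x00 x10 x01 x11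
    (bottom : {path I from x00 to x10}) (top : {path I from x01 to x11})
    (left : {path I from x00 to x01}) (right : {path I from x10 to x11}) :
  continuous S ->
  (forall s, bottom s = S (s, zero)) -> (forall s, top s = S (s, one)) ->
  (forall t, left t = S (zero, t)) -> (forall t, right t = S (one, t)) ->
  path_homotopic (concat bottom right) (concat left top).
Proof.
move=> cS Sb St Sl Sr.
pose c1 (s : I) : I := clamp (2 * coord s).
pose c2 (s : I) : I := clamp (2 * coord s - 1).
pose mix (a b : I -> I) (st : I * I) : I :=
  clamp (coord (a st.1) + coord st.2 * (coord (b st.1) - coord (a st.1))).
have cc1 : continuous c1 by apply: continuous_first_half; exact: continuous_id_all.
have cc2 : continuous c2 by apply: continuous_second_half; exact: continuous_id_all.
have cmix a b : continuous a -> continuous b -> continuous (mix a b).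
  move=> ca cb; apply: continuous_clamp_comp.
  have cfst (u : I -> I) : continuous u ->
      continuous (fun st : I * I => coord (u st.1)).
    move=> cu; apply: continuous_coord_comp.
    by apply: continuous_comp_all => //; exact: continuous_fst_all.
  apply: continuousD_all; first exact: cfst.
  apply: continuousM_all; last by apply: continuousB_all; exact: cfst.
  by apply: continuous_coord_comp; exact: continuous_snd_all.
have mix0 a b s : mix a b (s, zero) = a s.
  by rewrite /mix /= coord0 mul0r addr0 coordK.
have mix1 a b s : mix a b (s, one) = b s.
  by rewrite /mix /= coord1 mul1r subrKC coordK.
have c1_0 : c1 zero = zero by rewrite /c1 coord0 mulr0 clamp_le0.
have c2_0 : c2 zero = zero by rewrite /c2 coord0 clamp_le0 //; lra.
have c1_1 : c1 one = one by rewrite /c1 coord1 clamp_ge1 //; lra.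
have c2_1 : c2 one = one by rewrite /c2 coord1 clamp_ge1 //; lra.
exists (fun st => S (mix c1 c2 st, mix c2 c1 st)); split.
- by apply: continuous_comp_all => //; apply: continuous_pair; exact: cmix.
- move=> s; rewrite !mix0.
  have [s2|/ltW s2] := leP (coord s) 2^-1.
    by rewrite concat_le // Sb /c2 clamp_le0 //; lra.
  by rewrite concat_ge // Sr /c1 clamp_ge1 //; lra.
- move=> s; rewrite !mix1.
  have [s2|/ltW s2] := leP (coord s) 2^-1.
    by rewrite concat_le // Sl /c2 clamp_le0 //; lra.
  by rewrite concat_ge // St /c1 clamp_ge1 //; lra.
- move=> t; rewrite /mix /= c1_0 c2_0 subrr mulr0 addr0 coordK.
  by rewrite -Sb path_zero.
- move=> t; rewrite /mix /= c1_1 c2_1 subrr mulr0 addr0 coordK.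
  by rewrite -Sr path_one.
Qed.

End Homotopies.

Section UniformCloseness.
Variable R : realType.
Local Notation I := (unit_interval R).

Lemma unit_interval_compact : compact [set: I].
Proof.
have -> : [set: I] = @clamp R @` `[0, 1].
  apply/esym/seteqP; split=> // s _; exists (coord s); last exact: coordK.
  by rewrite /= in_itv /= coord_ge0 coord_le1.
apply: continuous_compact; last exact: segment_compact.
exact/continuous_subspaceT/continuous_clamp.
Qed.

Lemma nbhs_unit_interval (s : I) (U : set I) : nbhs s U ->
  exists2 e : R, 0 < e & forall t : I, `|coord s - coord t| < e -> U t.
Proof.
case=> _ [[V oV <-] Vs] VU; have := open_nbhs_nbhs (conj oV Vs).
case/nbhs_ballP => e e0 eV; exists e => // t st.
by apply: VU; apply: eV.
Qed.

(** Compactness of the square: closeness of values is uniform (the Lebesgue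
    number of a cover). *)
Lemma uniformly_close (Z : topologicalType) (close : Z -> Z -> Prop)
    (H : I * I -> Z) :
  (forall z : Z, exists2 U : set Z, nbhs z U & forall x y, U x -> U y -> close x y) ->
  continuous H ->
  exists2 e : R, 0 < e & forall a b : I * I,
    `|coord a.1 - coord b.1| < e -> `|coord a.2 - coord b.2| < e ->
    close (H a) (H b).
Proof.
move=> closeP cH.
have cII : compact [set: I * I].
  rewrite -setXTT; apply: compact_setX; exact: unit_interval_compact.
have /compact_near_coveringP cover := cII.
pose P (e : R) (a : I * I) := forall b,
  `|coord a.1 - coord b.1| < e -> `|coord a.2 - coord b.2| < e ->
  close (H a) (H b).
have : \forall e \near (0 : R)^'+, [set: I * I] `<=` P e.
  apply: cover => a _.
  have [U nU UP] := closeP (H a).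
  have [[A B] /= [nA nB] AB] : nbhs a (H @^-1` U) by exact: cH.
  have [e1 e10 e1A] := nbhs_unit_interval nA.
  have [e2 e20 e2B] := nbhs_unit_interval nB.
  pose e := Num.min e1 e2 / 2.
  have e0 : 0 < e by rewrite divr_gt0 // lt_min e10 e20.
  have ee1 : e + e <= e1 by rewrite -splitr ge_min lexx.
  have ee2 : e + e <= e2 by rewrite -splitr ge_min lexx orbT.
  exists ([set b : I * I | `|coord a.1 - coord b.1| < e] `&`
           [set b : I * I | `|coord a.2 - coord b.2| < e],
          [set d | 0 < d < e]) => /=.
  - split; first last.
      near=> d => /=; apply/andP; split; near: d; first exact: nbhs_right_gt.
      exact: nbhs_right_lt.
    have cont (u : I * I -> I) : continuous u ->
        nbhs a [set b | `|coord (u a) - coord (u b)| < e].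
      move=> cu; have : continuous (fun b => coord (u b)).
        exact: continuous_coord_comp.
      by move/(_ a)/cvgr_dist_lt; apply.
    by apply: filterI; apply: cont;
      [exact: continuous_fst_all | exact: continuous_snd_all].
  - case=> b d /= [[b1 b2] /andP[d0 de]] c c1 c2; apply: UP.
      by apply: (AB b); split; [apply: e1A | apply: e2B]; lra.
    apply: (AB c); split; [apply: e1A | apply: e2B] => /=.
      apply: (le_lt_trans (ler_distD (coord b.1) _ _)); lra.
    by apply: (le_lt_trans (ler_distD (coord b.2) _ _)); lra.
move=> ev; have [e [e0 eP]] : exists e : R, 0 < e /\ [set: I * I] `<=` P e.
  apply: (@filter_ex _ (0 : R)^'+).
  by apply: filterI ev; exact: nbhs_right_gt.
by exists e => // a b; exact: (eP a).
Unshelve. all: end_near.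
Qed.

End UniformCloseness.

(** * Functoriality and homotopy invariance of the fundamental group *)

#[global] Hint Resolve path_homotopic_refl : core.

Section PathCalculus.
Variables (R : realType) (X : topologicalType).
Local Notation I := (unit_interval R).
Implicit Types x y z w : X.

#[global] Instance path_homotopic_equivalence x y :
  RelationClasses.Equivalence (@path_homotopic R X x y).
Proof.
split.
- exact: path_homotopic_refl.
- exact: path_homotopic_sym.
- exact: path_homotopic_trans.
Qed.

#[global] Instance concat_proper x y z :
  Morphisms.Proper
    (Morphisms.respectful (@path_homotopic R X x y)
      (Morphisms.respectful (@path_homotopic R X y z)
        (@path_homotopic R X x z)))
    (@concat R X x y z).
Proof. by move=> p p' pp' q q' qq'; exact: concat_homotopic. Qed.

#[global] Instance reverse_proper x y :
  Morphisms.Proper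
    (Morphisms.respectful (@path_homotopic R X x y) (@path_homotopic R X y x))
    (@reverse R X x y).
Proof. by move=> p q; exact: reverse_homotopic. Qed.

Lemma path_homotopic_eq x y (p q : {path I from x to y}) :
  p =1 q -> path_homotopic p q.
Proof. by move/path_eqP->; exact: path_homotopic_refl. Qed.

Lemma reverse_const_path x :
  path_homotopic (reverse (const_path R x)) (const_path R x).
Proof. exact: path_homotopic_eq. Qed.

Lemma reverse_concat_homotopic x y (p : {path I from x to y}) :
  path_homotopic (concat (reverse p) p) (const_path R y).
Proof.
have := concat_reverse_homotopic (reverse p).
by have -> : reverse (reverse p) = p by apply/path_eqP/reverseK.
Qed.

Lemma concatKV_homotopic x y z (p : {path I from x to y})
    (q : {path I from y to z}) :
  path_homotopic (concat (reverse p) (concat p q)) q.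
Proof.
by rewrite concatA_homotopic reverse_concat_homotopic concat1_homotopic.
Qed.

Lemma concatVK_homotopic x y z (p : {path I from y to x})
    (q : {path I from y to z}) :
  path_homotopic (concat p (concat (reverse p) q)) q.
Proof.
by rewrite concatA_homotopic concat_reverse_homotopic concat1_homotopic.
Qed.

Definition conj_loop x y (a : {path I from x to y})
    (p : {path I from x to x}) : {path I from y to y} :=
  concat (reverse a) (concat p a).

Lemma conj_loop_homotopic x y (a : {path I from x to y}) p q :
  path_homotopic p q -> path_homotopic (conj_loop a p) (conj_loop a q).
Proof. by move=> pq; rewrite /conj_loop pq. Qed.

Lemma conj_loop_concat x y (a : {path I from x to y}) p q :
  path_homotopic (conj_loop a (concat p q))
    (concat (conj_loop a p) (conj_loop a q)).
Proof.
by rewrite /conj_loop -!concatA_homotopic concatVK_homotopic.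
Qed.

Lemma conj_loopK x y (a : {path I from x to y}) p :
  path_homotopic (conj_loop (reverse a) (conj_loop a p)) p.
Proof.
rewrite /conj_loop; have -> : reverse (reverse a) = a by apply/path_eqP/reverseK.
rewrite -!concatA_homotopic concatVK_homotopic concat_reverse_homotopic.
by rewrite concatp1_homotopic.
Qed.

End PathCalculus.

Lemma group_isomorphic_bij (G H : groupType) (f : G -> H) :
  {morph f : a b / (a * b)%g} -> bijective f -> group_isomorphic G H.
Proof.
move=> fM fbij.
pose fm := isMultiplicative.Build G H f fM.
by exists (HB.pack_for {multiplicative G -> H} f fm).
Qed.

Lemma group_isomorphic_trans (G H K : groupType) :
  group_isomorphic G H -> group_isomorphic H K -> group_isomorphic G K.
Proof.
case=> f fbij [g gbij]; apply: (@group_isomorphic_bij _ _ (g \o f)).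
  by move=> a b; rewrite /= !gmulfM.
exact: bij_comp.
Qed.

Section FundamentalGroupMaps.
Variable R : realType.
Local Notation I := (unit_interval R).
Implicit Types X Y Z : topologicalType.

Lemma pi1_ind X (x : X) (P : pi1 R x -> Prop) :
  (forall p, P (loop_class p)) -> forall a, P a.
Proof. by move=> HP a; rewrite -(loop_class_repr a). Qed.

Lemma loop_classM X (x : X) (p q : {path I from x to x}) :
  loop_class (concat p q) = (loop_class p * loop_class q)%g.
Proof. by rewrite -loop_class_concat. Qed.

Definition pi1_conj X (x y : X) (a : {path I from x to y}) (c : pi1 R x) :
    pi1 R y :=
  loop_class (conj_loop a (repr c)).

Lemma pi1_conjE X (x y : X) (a : {path I from x to y}) p :
  pi1_conj a (loop_class p) = loop_class (conj_loop a p).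
Proof. by apply/loop_classP/conj_loop_homotopic; exact: repr_loop_class. Qed.

Lemma pi1_conjK X (x y : X) (a : {path I from x to y}) :
  cancel (pi1_conj a) (pi1_conj (reverse a)).
Proof.
by elim/pi1_ind => p; rewrite !pi1_conjE; apply/loop_classP; exact: conj_loopK.
Qed.

Lemma pi1_conj_bij X (x y : X) (a : {path I from x to y}) :
  bijective (pi1_conj a).
Proof.
exists (pi1_conj (reverse a)); first exact: pi1_conjK.
have {2}<- : reverse (reverse a) = a by apply/path_eqP/reverseK.
exact: pi1_conjK.
Qed.

Lemma pi1_basepoint X (x y : X) (a : {path I from x to y}) :
  group_isomorphic (pi1 R x) (pi1 R y).
Proof.
apply: (@group_isomorphic_bij _ _ (pi1_conj a)); last exact: pi1_conj_bij.
elim/pi1_ind => p; elim/pi1_ind => q.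
rewrite -loop_classM !pi1_conjE -loop_classM.
by apply/loop_classP; exact: conj_loop_concat.
Qed.

Section MapPath.
Variables (X Y : topologicalType) (f : X -> Y) (cf : continuous f).

Lemma continuous_map_path x y (p : {path I from x to y}) : continuous (f \o p).
Proof. by apply: continuous_comp_all => //; exact: cts_fun. Qed.

Lemma map_path_zero x y (p : {path I from x to y}) : (f \o p) zero = f x.
Proof. by rewrite /= path_zero. Qed.

Lemma map_path_one x y (p : {path I from x to y}) : (f \o p) one = f y.
Proof. by rewrite /= path_one. Qed.

Definition map_path x y (p : {path I from x to y}) : {path I from f x to f y} :=
  mk_path (@continuous_map_path _ _ p) (map_path_zero p) (map_path_one p).

Lemma map_path_homotopic x y (p q : {path I from x to y}) :
  path_homotopic p q -> path_homotopic (map_path p) (map_path q).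
Proof.
case=> H [cH H0 H1 Hx Hy]; exists (f \o H); split=> //=.
- exact: continuous_comp_all.
- by move=> s; rewrite H0.
- by move=> s; rewrite H1.
- by move=> s; rewrite Hx.
- by move=> s; rewrite Hy.
Qed.

Lemma map_path_concat x y z (p : {path I from x to y})
    (q : {path I from y to z}) :
  map_path (concat p q) = concat (map_path p) (map_path q).
Proof.
apply/path_eqP => s; rewrite /= /mk_path /= /mk_path /concat_fun /=.
by case: ifP.
Qed.

Definition pi1_map x (a : pi1 R x) : pi1 R (f x) :=
  loop_class (map_path (repr a)).

Lemma pi1_mapE x (p : {path I from x to x}) :
  pi1_map (loop_class p) = loop_class (map_path p).
Proof. by apply/loop_classP/map_path_homotopic; exact: repr_loop_class. Qed.

Lemma pi1_mapM x : {morph @pi1_map x : a b / (a * b)%g}.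
Proof.
elim/pi1_ind => p; elim/pi1_ind => q.
by rewrite -loop_classM !pi1_mapE -loop_classM map_path_concat.
Qed.

End MapPath.

Arguments pi1_map {X Y f} cf {x} a.

(** A homotopy moves the base point along a path, and the square lemma says
    that it acts on loops as conjugation by this path. *)
Lemma pi1_map_homotopic_id X (f : X -> X) (cf : continuous f) :
  homotopic R f idfun -> forall x, bijective (pi1_map cf (x := x)).
Proof.
case=> H [cH H0 H1] x.
have ct : continuous (fun t => H (x, t)).
  apply: continuous_comp_all => //; apply: continuous_pair.
    exact: continuous_cst_all.
  exact: continuous_id_all.
pose tau : {path I from f x to x} := mk_path ct (H0 x) (H1 x).
have key p : path_homotopic (conj_loop tau (map_path cf p)) p.
  rewrite /conj_loop.
  have -> : path_homotopic (concat (map_path cf p) tau) (concat tau p).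
    apply: (@square_homotopic _ _ (fun st => H (p st.1, st.2))) => //.
    - apply: continuous_comp_all => //; apply: continuous_pair.
        apply: continuous_comp_all; first exact: cts_fun.
        exact: continuous_fst_all.
      exact: continuous_snd_all.
    - by move=> s; rewrite -[RHS]/(H (p s, one)) H1.
    - by move=> t; rewrite /= path_zero.
    - by move=> t; rewrite /= path_one.
  exact: concatKV_homotopic.
have mapK : cancel (pi1_map cf (x := x)) (pi1_conj tau).
  by elim/pi1_ind => p; rewrite pi1_mapE pi1_conjE; apply/loop_classP.
exists (pi1_conj tau) => // a.
by apply: (bij_inj (pi1_conj_bij tau)); rewrite mapK.
Qed.

Lemma pi1_map_comp X Y Z (f : X -> Y) (g : Y -> Z) (cf : continuous f)
    (cg : continuous g) (cgf : continuous (g \o f)) x (a : pi1 R x) :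
  pi1_map cgf a = pi1_map cg (pi1_map cf a).
Proof.
elim/pi1_ind: a => p; rewrite !pi1_mapE; apply/loop_classP.
exact: path_homotopic_eq.
Qed.

(** The induced maps compose to bijections in both orders, but at different
    base points: [g] is used at [f x], then [f] at [g (f x)]. *)
Theorem pi1_homotopy_equivalence X Y (f : X -> Y) (g : Y -> X) :
  continuous f -> continuous g ->
  homotopic R (g \o f) idfun -> homotopic R (f \o g) idfun ->
  forall x, group_isomorphic (pi1 R x) (pi1 R (f x)).
Proof.
move=> cf cg gf fg x.
have cgf : continuous (g \o f) by exact: continuous_comp_all.
have cfg : continuous (f \o g) by exact: continuous_comp_all.
have /bij_inj fgI := pi1_map_homotopic_id cfg fg (f x).
have gfB := pi1_map_homotopic_id cgf gf x.
apply: (group_isomorphic_bij (@pi1_mapM _ _ _ cf x)).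
have gB : bijective (pi1_map cg (x := f x)).
  have [h hK Kh] := gfB.
  have gI : injective (pi1_map cg (x := f x)).
    by move=> a b ab; apply: fgI; rewrite !(pi1_map_comp cg cf) ab.
  have hg : cancel (pi1_map cf \o h) (pi1_map cg (x := f x)).
    by move=> a; rewrite /= -(pi1_map_comp cf cg cgf) Kh.
  by exists (pi1_map cf \o h) => // a; apply: gI; rewrite hg.
have [k kK Kk] := gB.
apply: (@eq_bij _ _ (k \o pi1_map cgf (x := x))).
  apply: bij_comp gfB.
  by exists (pi1_map cg (x := f x)).
by move=> a; rewrite /= (pi1_map_comp cf cg cgf) kK.
Qed.

End FundamentalGroupMaps.

(** * The universal property of the free group *)

Section FreeLift.
Variable A : choiceType.
Local Open Scope group_scope.

Definition free_letter (l : A * bool) : free_group A :=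
  @FreeWord A [:: l] isT.

Definition free_gen (a : A) : free_group A := free_letter (a, true).

Variable H : groupType.
Implicit Types f : A -> H.

Definition letter_value f (l : A * bool) : H :=
  if l.2 then f l.1 else (f l.1)^-1.

Definition word_value f (w : seq (A * bool)) : H :=
  foldr (fun l c => letter_value f l * c) 1 w.

Definition free_lift f (w : free_group A) : H := word_value f w.

Lemma letter_value_inv f l :
  letter_value f (letter_inv l) = (letter_value f l)^-1.
Proof. by case: l => a []; rewrite /letter_value /= ?invgK. Qed.

Lemma word_value_push f l w :
  word_value f (push l w) = letter_value f l * word_value f w.
Proof.
case: w => //= m w; case: eqVneq => [->|_] //=.
by rewrite letter_value_inv mulKVg.
Qed.

Lemma free_liftM f : {morph free_lift f : v w / v * w}.
Proof.
case=> v rv [w rw]; rewrite /free_lift /= /reduce_cat.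
by elim: v {rv} => [|l v IH] /=; rewrite ?mul1g // word_value_push IH mulgA.
Qed.

Lemma free_lift_gen f a : free_lift f (free_gen a) = f a.
Proof. exact: mulg1. Qed.

Lemma morph_one (G K : groupType) (phi : G -> K) :
  {morph phi : v w / v * w} -> phi 1 = 1.
Proof. by move=> phiM; apply: (mulgI (phi 1)); rewrite -phiM !mulg1. Qed.

Lemma free_lift_unique (phi : free_group A -> H) :
  {morph phi : v w / v * w} -> phi =1 free_lift (fun a => phi (free_gen a)).
Proof.
move=> phiM; have phi1 : phi 1 = 1 by exact: morph_one.
have phi_letter l : phi (free_letter l) =
    letter_value (fun a => phi (free_gen a)) l.
  case: l => a [] //; rewrite /letter_value /=.
  apply: (mulgI (phi (free_gen a))); rewrite mulgV -phiM -phi1; congr phi.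
  by apply: val_inj; rewrite /= eqxx.
case=> w; elim: w => [|l w IH] rw.
  by rewrite /free_lift /= -phi1; congr phi; exact: val_inj.
have rw' : reduced w by exact: path_sorted rw.
rewrite [in LHS](_ : FreeWord rw = free_letter l * FreeWord rw').
  by rewrite phiM phi_letter IH.
apply: val_inj => /=.
by case: w rw {IH rw'} => //= m w; rewrite /reduced /= => /andP[/negbTE ->].
Qed.

End FreeLift.

(** * Holonomy of a local cocycle *)

(** A function [d] that is a cocycle on triples of close points gives a
    group-valued holonomy to each path: along the path the cocycle has a
    primitive [h], unique once its value at the origin is given. *)
Section Holonomy.
Variables (R : realType) (X : topologicalType) (G : groupType).
Local Notation I := (unit_interval R).
Local Open Scope group_scope.
Variables (close : X -> X -> Prop) (d : X -> X -> G).
Hypothesis close_local :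
  forall z : X, exists2 U : set X, nbhs z U & forall x y, U x -> U y -> close x y.
Hypothesis dM : forall x y z, close x y -> close y z -> close x z ->
  d x y * d y z = d x z.

Lemma close_refl x : close x x.
Proof. by have [U /nbhs_singleton Ux] := close_local x; apply. Qed.

Lemma d_refl x : d x x = 1.
Proof.
have xx := close_refl x.
by apply: (mulgI (d x x)); rewrite mulg1; exact: dM.
Qed.

Lemma path_uniformly_close (p : I -> X) : continuous p ->
  exists2 e : R, (0 < e)%R &
    forall s t, (`|coord s - coord t| < e)%R -> close (p s) (p t).
Proof.
move=> cp; have cp1 : continuous (fun st : I * I => p st.1).
  by apply: continuous_comp_all => //; exact: continuous_fst_all.
have [e e0 ep] := uniformly_close close_local cp1.
exists e => // s t st; apply: (ep (s, zero) (t, zero)) => //=.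
by rewrite subrr normr0.
Qed.

(** Finitely many steps of a length below [e] cover the unit interval. *)
Lemma interval_induction (P : R -> Prop) (e : R) : (0 < e)%R -> P 0%R ->
  (forall r r', (0 <= r)%R -> (r <= r')%R -> (r' <= 1)%R -> (r' - r < e)%R ->
    P r -> P r') ->
  forall r, (0 <= r <= 1)%R -> P r.
Proof.
move=> e0 P0 Pstep.
have [n ne] : exists n : nat, (n.+1%:R^-1 < e)%R.
  exists (Num.truncn e^-1); rewrite invf_plt ?posrE ?ltr0n //.
  by rewrite truncnS_gt // invr_ge0 ltW.
have n0 : (0 < n.+1%:R :> R)%R by rewrite ltr0n.
have ind m : forall r, (0 <= r <= 1)%R -> (r <= m%:R * n.+1%:R^-1)%R -> P r.
  elim: m => [|m IH] r /andP[r0 r1] rm.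
    rewrite mul0r in rm.
    by rewrite (_ : r = 0)%R //; apply/le_anti; rewrite r0 rm.
  have mn : (m.+1%:R * n.+1%:R^-1 = m%:R * n.+1%:R^-1 + n.+1%:R^-1 :> R)%R.
    by rewrite -natr1 mulrDl mul1r.
  have m0 : (0 <= m%:R * n.+1%:R^-1 :> R)%R by rewrite mulr_ge0 // invr_ge0 ltW.
  move: rm IH; rewrite {}mn; set q := (m%:R * _)%R in m0 *.
  set u := (n.+1%:R^-1)%R in ne * => rm IH.
  have [rq|qr] := leP r q; first by apply: IH => //; rewrite r0.
  by apply: (Pstep q); try lra; apply: IH => //; lra.
by move=> r r01; apply: (ind n.+1) => //; rewrite divff ?gt_eqF //; case/andP: r01.
Qed.

Definition primitive (p : I -> X) (h : I -> G) : Prop :=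
  exists2 e : R, (0 < e)%R & forall s t,
    (`|coord s - coord t| < e)%R -> h t = h s * d (p s) (p t).

Definition holonomy (p : I -> X) (a : G) : Prop :=
  exists h, [/\ primitive p h, h zero = 1 & h one = a].

(** A primitive on the parameters up to [r] is continued a little beyond [r]
    with the cocycle from the point at [r]. *)
Lemma primitive_exists (p : I -> X) : continuous p ->
  exists2 h, primitive p h & h zero = 1.
Proof.
move=> cp; have [e e0 pe] := path_uniformly_close cp.
pose P (r : R) := exists h : I -> G, h zero = 1 /\ forall s t,
  (coord s <= r)%R -> (coord t <= r)%R -> (`|coord s - coord t| < e)%R ->
  h t = h s * d (p s) (p t).
suff [h [h0 hP]] : P 1%R.
  exists h => //; exists e => // s t st; apply: hP => //; exact: coord_le1.
apply: (@interval_induction P e e0).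
- exists (fun=> 1); split=> // s t s0 t0 _.
  have zE (u : I) : (coord u <= 0)%R -> u = zero.
    by move=> u0; rewrite -(coordK u) clamp_le0.
  by rewrite (zE s) // (zE t) // d_refl mulg1.
- move=> r r' r0 rr' r'1 rre [h [h0 hP]].
  have r01 : (0 <= r <= 1)%R by apply/andP; split => //; lra.
  have cr : coord (clamp r) = r by exact: coord_clamp_id.
  exists (fun s => if (coord s <= r)%R then h s
                   else h (clamp r) * d (p (clamp r)) (p s)); split.
    by rewrite coord0 r0.
  have cl a b : (`|coord a - coord b| < e)%R -> close (p a) (p b) by exact: pe.
  have close_r a : (`|r - coord a| < e)%R ->
      close (p a) (p (clamp r)) /\ close (p (clamp r)) (p a).
    by move=> ra; split; apply: cl; rewrite cr // distrC.
  move=> s t sr' tr' st; have {}st' := cl _ _ st.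
  case: (leP (coord s) r) => sr; case: (leP (coord t) r) => tr.
  + exact: hP.
  + have [_ rt] : close (p t) (p (clamp r)) /\ close (p (clamp r)) (p t).
      by apply: close_r; rewrite ltr_norml; lra.
    have [sr1 _] : close (p s) (p (clamp r)) /\ close (p (clamp r)) (p s).
      by apply: close_r; move: st; rewrite !ltr_norml; lra.
    rewrite -(dM sr1 rt st') mulgA; congr (_ * _); apply: hP; rewrite ?cr //.
    by move: st; rewrite !ltr_norml; lra.
  + have [_ rs] : close (p s) (p (clamp r)) /\ close (p (clamp r)) (p s).
      by apply: close_r; rewrite ltr_norml; lra.
    have [_ rt] : close (p t) (p (clamp r)) /\ close (p (clamp r)) (p t).
      by apply: close_r; move: st; rewrite !ltr_norml; lra.
    rewrite -mulgA (dM rs st' rt); apply: hP; rewrite ?cr //.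
    by move: st; rewrite !ltr_norml; lra.
  + have [_ rs] : close (p s) (p (clamp r)) /\ close (p (clamp r)) (p s).
      by apply: close_r; rewrite ltr_norml; lra.
    have [_ rt] : close (p t) (p (clamp r)) /\ close (p (clamp r)) (p t).
      by apply: close_r; rewrite ltr_norml; lra.
    by rewrite -mulgA (dM rs st' rt).
- by rewrite ler01 lexx.
Qed.

Lemma holonomy_exists (p : I -> X) : continuous p -> exists a, holonomy p a.
Proof.
by move=> /primitive_exists[h hp h0]; exists (h one), h.
Qed.

(** Two primitives that agree at a parameter agree at all nearby ones. *)
Lemma holonomy_unique (p : I -> X) a b : holonomy p a -> holonomy p b -> a = b.
Proof.
case=> h [[e e0 hP] h0 <-] [k [[f f0 kP] k0 <-]].
pose P (r : R) := h (clamp r) = k (clamp r).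
have : P 1%R.
  apply: (@interval_induction P (Num.min e f)).
  - by rewrite lt_min e0.
  - by rewrite /P clamp_le0 // h0 k0.
  - move=> r r' r0 rr' r'1; rewrite lt_min => /andP[re rf]; rewrite /P => hk.
    have c1 : coord (clamp r) = r by rewrite coord_clamp_id; lra.
    have c2 : coord (clamp r') = r' by rewrite coord_clamp_id; lra.
    rewrite (hP (clamp r)) ?(kP (clamp r) (clamp r')) ?hk //.
      by rewrite c1 c2 ltr_norml; lra.
    by rewrite c1 c2 ltr_norml; lra.
  - by rewrite ler01 lexx.
by rewrite /P clamp_ge1.
Qed.

(** A primitive at one stage of a homotopy, multiplied by the cocycle towards
    the next stage, is a primitive at the next stage.  The values at the end
    points do not change, as the cocycle is trivial on constant pairs. *)
Lemma holonomy_homotopic (x y : X) (p q : {path I from x to y}) a :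
  path_homotopic p q -> holonomy p a -> holonomy q a.
Proof.
case=> H [cH H0 H1 Hx Hy] hp.
have [e e0 He] := uniformly_close close_local cH.
pose P (r : R) := holonomy (fun s => H (s, clamp r)) a.
have : P 1%R.
  apply: (@interval_induction P e e0).
  - rewrite /P clamp_le0 //; case: hp => h [[f f0 hP] h0 h1].
    by exists h; split=> //; exists f => // s t st; rewrite !H0; exact: hP.
  - move=> r r' r0 rr' r'1 rre [h [[f f0 hP] h0 h1]].
    have c1 : coord (clamp r) = r by rewrite coord_clamp_id; lra.
    have c2 : coord (clamp r') = r' by rewrite coord_clamp_id; lra.
    exists (fun s => h s * d (H (s, clamp r)) (H (s, clamp r'))); split.
    + exists (Num.min e f) => [|s t]; first by rewrite lt_min e0.
      rewrite lt_min => /andP[se sf].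
      rewrite (hP s t sf) -!mulgA; congr (_ * _).
      have cl s' t' u u' : (`|coord s' - coord t'| < e)%R ->
          (u == clamp r) || (u == clamp r') ->
          (u' == clamp r) || (u' == clamp r') -> close (H (s', u)) (H (t', u')).
        move=> st' uu uu'; apply: He => //=.
        by case/orP: uu => /eqP->; case/orP: uu' => /eqP->;
          rewrite ?c1 ?c2 ?subrr ?normr0 // ltr_norml; lra.
      by rewrite !dM //; apply: cl; rewrite ?subrr ?normr0 ?eqxx ?orbT.
    + by rewrite !Hx d_refl mulg1.
    + by rewrite !Hy d_refl mulg1.
  - by rewrite ler01 lexx.
rewrite /P clamp_ge1 // => -[h [[f f0 hP] h0 h1]].
by exists h; split=> //; exists f => // s t st; rewrite -!H1; exact: hP.
Qed.

(** The primitive of the second path, multiplied by [a], continues the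
    primitive of the first one: for close points on both sides of the midpoint
    the cocycle factors through the midpoint. *)
Lemma holonomy_concat (x y z : X) (p : {path I from x to y})
    (q : {path I from y to z}) a b :
  holonomy p a -> holonomy q b -> holonomy (concat p q) (a * b).
Proof.
case=> h [[e e0 hP] h0 h1] [k [[f f0 kP] k0 k1]].
have [g g0 gP] := path_uniformly_close (@continuous_concat R X x y z p q).
have {}gP s t : (`|coord s - coord t| < g)%R ->
  close (concat p q s) (concat p q t) by exact: gP.
pose l s := h (clamp (2 * coord s)); pose m s := a * k (clamp (2 * coord s - 1)).
have clE s : (coord s <= 2^-1)%R -> coord (clamp (2 * coord s)) = (2 * coord s)%R.
  by move=> s2; have := coord_ge0 s => s0; rewrite coord_clamp_id; lra.
have cgE s : (2^-1 <= coord s)%R ->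
    coord (clamp (2 * coord s - 1)) = (2 * coord s - 1)%R.
  by move=> s2; have := coord_le1 s => s1; rewrite coord_clamp_id; lra.
pose mid : I := clamp 2^-1.
have cmid : coord mid = (2^-1)%R by rewrite coord_clamp_id; lra.
have lP s t : (coord s <= 2^-1)%R -> (coord t <= 2^-1)%R ->
    (`|coord s - coord t| < e / 2)%R ->
    l t = l s * d (concat p q s) (concat p q t).
  move=> s2 t2 st; rewrite !concat_le //; apply: hP; rewrite !clE //.
  by move: st; rewrite !ltr_norml; lra.
have mP s t : (2^-1 <= coord s)%R -> (2^-1 <= coord t)%R ->
    (`|coord s - coord t| < f / 2)%R ->
    m t = m s * d (concat p q s) (concat p q t).
  move=> s2 t2 st; rewrite !concat_ge // -mulgA; congr (_ * _); apply: kP.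
  by rewrite !cgE //; move: st; rewrite !ltr_norml; lra.
have lm : l mid = m mid.
  by rewrite /l /m cmid clamp_ge1 ?clamp_le0 ?h1 ?k0 ?mulg1 //; lra.
exists (fun s => if (coord s <= 2^-1)%R then l s else m s); split.
- exists (Num.min g (Num.min (e / 2) (f / 2)))%R => [|s t].
    by rewrite !lt_min g0 !divr_gt0.
  rewrite !lt_min => /and3P[sg se sf].
  case: (leP (coord s) _) => s2; case: (leP (coord t) _) => t2.
  + exact: lP.
  + have st' : (`|coord s - coord mid| < Num.min g (e / 2))%R.
      rewrite lt_min; move: sg se; rewrite cmid !ltr_norml.
      by move=> ? ?; apply/andP; split; lra.
    have ts' : (`|coord mid - coord t| < Num.min g (f / 2))%R.
      rewrite lt_min; move: sg sf; rewrite cmid !ltr_norml.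
      by move=> ? ?; apply/andP; split; lra.
    move: st' ts'; rewrite !lt_min => /andP[st1 st2] /andP[ts1 ts2].
    have Ls : l mid = l s * d (concat p q s) (concat p q mid).
      by apply: lP => //; rewrite cmid.
    rewrite -(dM (gP _ _ st1) (gP _ _ ts1) (gP _ _ sg)) mulgA -Ls lm.
    by apply: mP => //; rewrite ?cmid // ltW.
  + have st' : (`|coord s - coord mid| < Num.min g (f / 2))%R.
      rewrite lt_min; move: sg sf; rewrite cmid !ltr_norml.
      by move=> ? ?; apply/andP; split; lra.
    have ts' : (`|coord mid - coord t| < Num.min g (e / 2))%R.
      rewrite lt_min; move: sg se; rewrite cmid !ltr_norml.
      by move=> ? ?; apply/andP; split; lra.
    move: st' ts'; rewrite !lt_min => /andP[sm1 sm2] /andP[mt1 mt2].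
    have Ms : m mid = m s * d (concat p q s) (concat p q mid).
      by apply: mP => //; rewrite ?cmid // ltW.
    rewrite -(dM (gP _ _ sm1) (gP _ _ mt1) (gP _ _ sg)) mulgA -Ms -lm.
    by apply: lP => //; rewrite cmid.
  + by apply: mP => //; exact: ltW.
- by rewrite coord0 ifT ?/l ?coord0 ?mulr0 ?clamp_le0 //; lra.
- rewrite coord1 ifF; last by apply/negbTE; rewrite -ltNge; lra.
  by rewrite /m coord1 clamp_ge1 ?k1 //; lra.
Qed.

End Holonomy.

(** * Polyhedra of finite simplicial complexes *)

Section Polyhedron.
Variables (R : realType) (V : finType).
Local Notation I := (unit_interval R).

Definition is_complex (K : {set {set V}}) : Prop :=
  [/\ finset.set0 \notin K,
      forall s s' : {set V}, s \in K -> s' \subset s -> s' != finset.set0 -> s' \in K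
    & forall v, [set v]%SET \in K].

Definition polyhedron (K : {set {set V}}) : topologicalType :=
  set_type (@realization R V K).

Definition supp (w : V -> R) : {set V} := [set v | w v != 0]%SET.

Variable K : {set {set V}}.
Hypothesis Kcplx : is_complex K.
Implicit Types (x y : polyhedron K) (u v : V).

Definition bary x : V -> R := set_val x.

Lemma baryP x : [/\ forall v, 0 <= bary x v, \sum_v bary x v = 1 &
  supp (bary x) \in K].
Proof. exact: (set_mem (valP x)). Qed.

Lemma bary_ge0 x v : 0 <= bary x v. Proof. by case: (baryP x). Qed.

Lemma bary_sum x : \sum_v bary x v = 1. Proof. by case: (baryP x). Qed.

Lemma supp_bary x : supp (bary x) \in K. Proof. by case: (baryP x). Qed.

Lemma bary_inj x y : bary x =1 bary y -> x = y.
Proof. by move=> /funext xy; exact: val_inj. Qed.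

Lemma bary_outside y (s : {set V}) v :
  supp (bary y) \subset s -> v \notin s -> bary y v = 0.
Proof.
move=> /fintype.subsetP ys vs; apply/eqP; apply: contraNT vs => yv.
by apply: ys; rewrite inE.
Qed.

Lemma bary_pair y u v : u != v -> supp (bary y) \subset [set u; v]%SET ->
  bary y u + bary y v = 1.
Proof.
move=> uv ys; rewrite -(bary_sum y) (bigD1 u) //= (bigD1 v) 1?eq_sym //=.
rewrite big1 ?addr0 // => w /andP[wu wv]; apply: bary_outside ys _.
by rewrite !inE negb_or wu wv.
Qed.

Lemma continuous_bary v : continuous (fun x => bary x v).
Proof.
apply: (@continuous_comp_all _ {ptws V -> R} _ set_val (fun w => w v)).
  exact: (@proj_continuous V (fun=> R) v).
exact: continuous_set_val.
Qed.

Lemma continuous_polyhedron (Z : topologicalType) (f : Z -> polyhedron K) :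
  (forall v, continuous (fun z => bary (f z) v)) -> continuous f.
Proof.
move=> cf; apply: continuous_into_subset.
by apply: (@continuous_into_product V (fun=> R)).
Qed.

Lemma mkpoint_subproof (w : V -> R) :
  [/\ forall v, 0 <= w v, \sum_v w v = 1 & supp w \in K] ->
  (w : {ptws V -> R}) \in @realization R V K.
Proof. by move=> ?; exact: mem_set. Qed.

Definition mkpoint (w : V -> R)
    (Hw : [/\ forall v, 0 <= w v, \sum_v w v = 1 & supp w \in K]) :
    polyhedron K :=
  exist (fun w : {ptws V -> R} => w \in @realization R V K) _
    (mkpoint_subproof Hw).

Definition weights (w : V -> R) : Prop := (forall v, 0 <= w v) /\ supp w \in K.

Lemma weights_sum_gt0 w : weights w -> 0 < \sum_v w v.
Proof.
case=> w0 wK; have [K0 _ _] := Kcplx.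
have /finset.set0Pn[v] : supp w != finset.set0.
  by apply: contraNneq K0 => <-.
rewrite inE => wv; rewrite (bigD1 v) //=.
by rewrite ltr_pwDl ?sumr_ge0 // lt_def wv w0.
Qed.

Lemma normalize_subproof w : weights w ->
  let w' v := w v / \sum_u w u in
  [/\ forall v, 0 <= w' v, \sum_v w' v = 1 & supp w' \in K].
Proof.
move=> ww /=; have w_gt0 := weights_sum_gt0 ww; case: ww => w0 wK; split.
- by move=> v; rewrite divr_ge0 // ltW.
- by rewrite -mulr_suml divff // gt_eqF.
- have -> // : supp (fun v => w v / \sum_u w u) = supp w.
  by apply/setP => v; rewrite !inE mulf_eq0 invr_eq0 (gt_eqF w_gt0) orbF.
Qed.

(** Maps into a polyhedron are given below by nonnegative weights with support
    a simplex, up to this normalization. *)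
Definition normalize w (ww : weights w) : polyhedron K :=
  mkpoint (normalize_subproof ww).

Lemma bary_normalize w (ww : weights w) v :
  bary (normalize ww) v = w v / \sum_u w u.
Proof. by []. Qed.

Lemma supp_normalize w (ww : weights w) : supp (bary (normalize ww)) = supp w.
Proof.
apply/setP => v; rewrite !inE bary_normalize mulf_eq0 invr_eq0.
by rewrite (gt_eqF (weights_sum_gt0 ww)) orbF.
Qed.

Lemma continuous_normalize (Z : topologicalType) (w : Z -> V -> R)
    (ww : forall z, weights (w z)) :
  (forall v, continuous (fun z => w z v)) ->
  continuous (fun z => normalize (ww z)).
Proof.
move=> cw; apply: continuous_polyhedron => v.
apply: continuousM_all; first exact: cw.
apply: continuousV_all => [z|]; last exact: continuous_sum_all.
by rewrite gt_eqF // weights_sum_gt0.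
Qed.

Definition joined x y : Prop := supp (bary x) :|: supp (bary y) \in K.

Lemma joined_simplex x y (s : {set V}) : s \in K ->
  supp (bary x) \subset s -> supp (bary y) \subset s -> joined x y.
Proof.
move=> sK xs ys; have [K0 Kdown _] := Kcplx.
apply: (Kdown s) => //; first by rewrite finset.subUset xs.
apply: contraNneq K0 => xy0; have := supp_bary x.
suff -> : supp (bary x) = finset.set0 by [].
by apply/eqP; rewrite -finset.subset0 -xy0 finset.subsetUl.
Qed.

Lemma mix_subproof x y (t : I) : joined x y ->
  let w v := (1 - coord t) * bary x v + coord t * bary y v in
  [/\ forall v, 0 <= w v, \sum_v w v = 1 & supp w \in K].
Proof.
move=> xyK /=; have t0 := coord_ge0 t; have t1 := coord_le1 t.
have [K0 Kdown _] := Kcplx.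
have w0 v : 0 <= (1 - coord t) * bary x v + coord t * bary y v.
  by rewrite addr_ge0 // mulr_ge0 ?bary_ge0 ?subr_ge0.
have w1 : \sum_v ((1 - coord t) * bary x v + coord t * bary y v) = 1.
  by rewrite big_split /= -!mulr_sumr !bary_sum !mulr1 subrK.
split=> //; apply: (Kdown _ _ xyK).
  apply/fintype.subsetP => v; rewrite !inE; apply: contraNT; rewrite negb_or !negbK.
  by case/andP => /eqP-> /eqP->; rewrite !mulr0 addr0.
apply/eqP => s0; have := w1; rewrite big1 => [/esym/eqP|v _].
  by rewrite oner_eq0.
apply/eqP; apply: contraT => vs.
by have := finset.in_set0 v; rewrite -s0 inE vs.
Qed.

Definition mix x y (xy : joined x y) (t : I) : polyhedron K :=
  mkpoint (mix_subproof t xy).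

Lemma bary_mix x y (xy : joined x y) t v :
  bary (mix xy t) v = (1 - coord t) * bary x v + coord t * bary y v.
Proof. by []. Qed.

Lemma mix0 x y (xy : joined x y) : mix xy zero = x.
Proof. by apply: bary_inj => v; rewrite bary_mix coord0; lra. Qed.

Lemma mix1 x y (xy : joined x y) : mix xy one = y.
Proof. by apply: bary_inj => v; rewrite bary_mix coord1; lra. Qed.

Lemma supp_mix x y (xy : joined x y) t :
  supp (bary (mix xy t)) \subset supp (bary x) :|: supp (bary y).
Proof.
apply/fintype.subsetP => v; rewrite !inE bary_mix; apply: contraNT.
by rewrite negb_or !negbK => /andP[/eqP-> /eqP->]; rewrite !mulr0 addr0.
Qed.

Lemma continuous_mix (Z : topologicalType) (f g : Z -> polyhedron K)
    (fg : forall z, joined (f z) (g z)) (t : Z -> I) :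
  continuous f -> continuous g -> continuous t ->
  continuous (fun z => mix (fg z) (t z)).
Proof.
move=> cf cg ct; apply: continuous_polyhedron => v.
have cb (h : Z -> polyhedron K) : continuous h ->
    continuous (fun z => bary (h z) v).
  move=> ch; apply: (@continuous_comp_all _ _ _ h (fun x => bary x v)) => //.
  exact: continuous_bary.
have ct' : continuous (fun z => coord (t z)) by exact: continuous_coord_comp.
apply: continuousD_all; apply: continuousM_all => //; try exact: cb.
by apply: continuousB_all => //; exact: continuous_cst_all.
Qed.

(** The straight-line homotopy stays in the polyhedron when both images of
    each point lie in a common simplex. *)
Lemma straight_homotopic (Z : topologicalType) (f g : Z -> polyhedron K) :
  continuous f -> continuous g -> (forall z, joined (f z) (g z)) ->
  homotopic R f g.
Proof.
move=> cf cg fg; exists (fun zt => mix (fg zt.1) zt.2); split.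
- apply: (@continuous_mix _ (f \o fst) (g \o fst) (fun zt => fg zt.1) snd).
  + by apply: continuous_comp_all => //; exact: continuous_fst_all.
  + by apply: continuous_comp_all => //; exact: continuous_fst_all.
  + exact: continuous_snd_all.
- by move=> z; exact: mix0.
- by move=> z; exact: mix1.
Qed.

Lemma continuous_segment x y (xy : joined x y) : continuous (mix xy).
Proof.
apply: (@continuous_mix _ (fun=> x) (fun=> y) (fun=> xy) id).
- exact: continuous_cst_all.
- exact: continuous_cst_all.
- exact: continuous_id_all.
Qed.

Definition segment x y (xy : joined x y) : {path I from x to y} :=
  mk_path (@continuous_segment x y xy) (mix0 xy) (mix1 xy).

Lemma vertex_subproof v : let w u : R := (u == v)%:R in
  [/\ forall u, 0 <= w u, \sum_u w u = 1 & supp w \in K].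
Proof.
have [_ _ Kv] := Kcplx; split=> [u||]; first exact: ler0n.
  rewrite (bigD1 v) //= eqxx big1 ?addr0 // => u /negbTE->.
  by [].
suff -> : supp (fun u => (u == v)%:R) = [set v]%SET by [].
by apply/setP => u; rewrite !inE pnatr_eq0 eqb0 negbK.
Qed.

Definition vertex v : polyhedron K := mkpoint (vertex_subproof v).

Lemma bary_vertex v u : bary (vertex v) u = (u == v)%:R. Proof. by []. Qed.

Lemma supp_vertex v : supp (bary (vertex v)) = [set v]%SET.
Proof.
by apply/setP => u; rewrite !inE bary_vertex pnatr_eq0 eqb0 negbK.
Qed.

Lemma bary_single y v : supp (bary y) \subset [set v]%SET -> y = vertex v.
Proof.
move=> ys; apply: bary_inj => u; rewrite bary_vertex.
case: eqVneq => [->|uv]; last by apply: bary_outside ys _; rewrite inE.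
rewrite -(bary_sum y) (bigD1 v) //= big1 ?addr0 // => w wv.
by apply: bary_outside ys _; rewrite inE.
Qed.

Lemma joined_vertices (u v : V) :
  [set u; v]%SET \in K -> joined (vertex u) (vertex v).
Proof. by rewrite /joined !supp_vertex. Qed.

Lemma joined_refl x : joined x x.
Proof. by rewrite /joined finset.setUid supp_bary. Qed.

Lemma joined_vertex x v : v \in supp (bary x) -> joined x (vertex v).
Proof.
move=> vx; apply: (@joined_simplex _ _ (supp (bary x))) => //.
  exact: supp_bary.
by rewrite supp_vertex finset.sub1set.
Qed.

Lemma segment_refl x (xx : joined x x) :
  path_homotopic (segment xx) (const_path R x).
Proof.
apply: path_homotopic_eq => t; apply: bary_inj => v.
by rewrite -[LHS]/(bary (mix xx t) v) bary_mix -mulrDl subrK mul1r.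
Qed.

Lemma segment_reverse x y (xy : joined x y) (yx : joined y x) :
  path_homotopic (reverse (segment xy)) (segment yx).
Proof.
apply: path_homotopic_eq => t; apply: bary_inj => v.
rewrite -[LHS]/(bary (mix xy (flip t)) v) -[RHS]/(bary (mix yx t) v) !bary_mix.
rewrite /flip coord_clamp_id; first lra.
by have := coord_ge0 t; have := coord_le1 t; lra.
Qed.

(** * Large coordinates and edge cocycles *)

(** A point has a coordinate at least as large as the mean value of its
    coordinates. *)
Definition mesh : R := #|V|%:R^-1.

Lemma large_coordinate_exists x : exists v, mesh <= bary x v.
Proof.
apply: contrapT => /forallNP small.
have V0 : (0 < #|V|)%N.
  apply/card_gt0P; have [K0 _ _] := Kcplx.
  have /finset.set0Pn[v _] : supp (bary x) != finset.set0.
    by apply: contraNneq K0 => <-; exact: supp_bary.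
  by exists v.
have : \sum_v bary x v < \sum_(v : V) mesh.
  have /card_gt0P[v0 _] := V0.
  apply: ltr_sum; first by apply/hasP; exists v0 => //; rewrite mem_index_enum.
  by move=> v _; rewrite ltNge; apply/negP/small.
rewrite bary_sum sumr_const -mulr_natr mulVf ?ltxx //.
by rewrite pnatr_eq0 -lt0n.
Qed.

Definition large_coordinate x : V := xchoose (large_coordinate_exists x).

Lemma large_coordinateP x : mesh <= bary x (large_coordinate x).
Proof. exact: (xchooseP (large_coordinate_exists x)). Qed.

Lemma mesh_gt0 (v : V) : 0 < mesh.
Proof. by rewrite invr_gt0 ltr0n; apply/card_gt0P; exists v. Qed.

Lemma large_coordinate_vertex v : large_coordinate (vertex v) = v.
Proof.
have := large_coordinateP (vertex v); rewrite bary_vertex.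
by case: eqP => //= _; rewrite leNgt (mesh_gt0 v).
Qed.

Definition close x y : Prop := forall v, `|bary x v - bary y v| < mesh.

Lemma close_sym x y : close x y -> close y x.
Proof. by move=> xy v; rewrite distrC. Qed.

Lemma close_local x : exists2 U : set (polyhedron K), nbhs x U &
  forall y z, U y -> U z -> close y z.
Proof.
exists [set y | forall v, `|bary x v - bary y v| < mesh / 2].
  apply: (@filter_forall _ V
    (fun v => [set y | `|bary x v - bary y v| < mesh / 2]) (nbhs x) (nbhs_filter x)).
  move=> v; have := @continuous_bary v x.
  by move/cvgr_dist_lt; apply; rewrite divr_gt0 ?mesh_gt0.
move=> y z xy xz v; have := xy v; have := xz v.
by rewrite !ltr_norml; lra.
Qed.

(** A coordinate as large as the mesh cannot vanish at a close point, so the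
    simplex spanned by a point sees the large coordinates of all close points. *)
Lemma large_coordinate_supp x y :
  close x y -> large_coordinate x \in supp (bary y).
Proof.
move=> xy; rewrite inE; apply/eqP => y0.
have := xy (large_coordinate x); rewrite y0 subr0 ger0_norm ?bary_ge0 //.
by rewrite ltNge large_coordinateP.
Qed.

Variables (G : groupType) (g : V -> V -> G).
Hypothesis gM : forall (s : {set V}) u v w, s \in K ->
  u \in s -> v \in s -> w \in s -> (g u v * g v w = g u w)%g.

Definition point_cocycle x y : G := g (large_coordinate x) (large_coordinate y).

Lemma point_cocycleM x y z : close x y -> close y z -> close x z ->
  (point_cocycle x y * point_cocycle y z = point_cocycle x z)%g.
Proof.
move=> xy yz xz; apply: (gM (supp_bary y)).
- exact: large_coordinate_supp.
- by apply: large_coordinate_supp; exact: (close_refl close_local).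
- by apply: large_coordinate_supp; exact: close_sym.
Qed.

Lemma holonomy_segment (u v : V) (uv : joined (vertex u) (vertex v)) :
  holonomy point_cocycle (segment uv) (g u v).
Proof.
have uvK : [set u; v]%SET \in K by move: uv; rewrite /joined !supp_vertex.
have lP s : large_coordinate (mix uv s) \in [set u; v]%SET.
  have := fintype.subsetP (supp_mix uv s) (large_coordinate (mix uv s)).
  rewrite !supp_vertex; apply; apply: large_coordinate_supp.
  exact: (close_refl close_local).
have u_uv : u \in [set u; v]%SET by rewrite !inE eqxx.
exists (fun s => g u (large_coordinate (mix uv s))); split.
- by exists 1 => // s t _; rewrite (gM uvK u_uv (lP s) (lP t)).
- rewrite mix0 large_coordinate_vertex; apply: (mulgI (g u u)).
  by rewrite (gM uvK) // mulg1.
- by rewrite mix1 large_coordinate_vertex.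
Qed.

End Polyhedron.

(** * Loops are determined by their holonomy *)

Section Subpath.
Variables (R : realType) (X : topologicalType).
Local Notation I := (unit_interval R).
Variables (p : I -> X) (cp : continuous p).

Definition affine_param (r r' : R) (s : I) : I :=
  clamp (r + coord s * (r' - r)).

Lemma continuous_affine_param r r' : continuous (affine_param r r').
Proof.
apply: continuous_clamp_comp; apply: continuousD_all.
  exact: continuous_cst_all.
apply: continuousM_all; last exact: continuous_cst_all.
exact: continuous_coord.
Qed.

Lemma affine_param0 r r' : affine_param r r' zero = clamp r.
Proof. by rewrite /affine_param coord0 mul0r addr0. Qed.

Lemma affine_param1 r r' : affine_param r r' one = clamp r'.
Proof. by rewrite /affine_param coord1 mul1r subrKC. Qed.

Variables (r r' : R) (x y : X).
Hypotheses (Hx : p (clamp r) = x) (Hy : p (clamp r') = y).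

Lemma continuous_subpath : continuous (p \o affine_param r r').
Proof. by apply: continuous_comp_all => //; exact: continuous_affine_param. Qed.

Lemma subpath_zero : (p \o affine_param r r') zero = x.
Proof. by rewrite /= affine_param0. Qed.

Lemma subpath_one : (p \o affine_param r r') one = y.
Proof. by rewrite /= affine_param1. Qed.

Definition subpath : {path I from x to y} :=
  mk_path continuous_subpath subpath_zero subpath_one.

End Subpath.

Lemma subpath_concat (R : realType) (X : topologicalType)
    (p : unit_interval R -> X) (cp : continuous p) (r r' r'' : R) (x y z : X)
    (Hx : p (clamp r) = x) (Hy : p (clamp r') = y) (Hz : p (clamp r'') = z) :
  path_homotopic (concat (subpath cp Hx Hy) (subpath cp Hy Hz))
    (subpath cp Hx Hz).
Proof.
pose a (s : unit_interval R) := clamp (r + coord (clamp (2 * coord s)) * (r' - r)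
  + coord (clamp (2 * coord s - 1)) * (r'' - r')).
have c1 : coord (clamp 1 : unit_interval R) = 1 by rewrite coord_clamp_id; lra.
have c0 : coord (clamp 0 : unit_interval R) = 0 by rewrite coord_clamp_id; lra.
have e0 : clamp (2 * 0 - 1) = zero :> unit_interval R by rewrite clamp_le0 //; lra.
have e1 : clamp (2 * 1) = one :> unit_interval R by rewrite clamp_ge1 //; lra.
apply: (@reparam_homotopic _ _ _ _ _ _ p a (affine_param r r'')) => //.
- apply: continuous_clamp_comp; apply: continuousD_all.
    apply: continuousD_all; first exact: continuous_cst_all.
    apply: continuousM_all; last exact: continuous_cst_all.
    apply: continuous_coord_comp.
    by apply: continuous_first_half; exact: continuous_id_all.
  apply: continuousM_all; last exact: continuous_cst_all.
  apply: continuous_coord_comp.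
  by apply: continuous_second_half; exact: continuous_id_all.
- exact: continuous_affine_param.
- by rewrite affine_param0 /a coord0 e0 mulr0 !coord0 ?c0 !mul0r !addr0.
- rewrite affine_param1 /a coord1 e1 !coord1.
  rewrite (_ : (2 * 1 - 1 : R) = 1); last lra.
  by rewrite ?c1 !mul1r; congr clamp; lra.
- move=> s /=; have [s2|/ltW s2] := leP (coord s) 2^-1.
    rewrite concat_le //= /mk_path /= /affine_param /a.
    by rewrite [clamp (_ - 1)]clamp_le0 ?coord0 ?mul0r ?addr0 //; lra.
  rewrite concat_ge //= /mk_path /= /affine_param /a.
  rewrite [clamp (2 * coord s)]clamp_ge1 ?coord1 ?mul1r; last lra.
  by rewrite subrKC.
Qed.

(** If the class of each edge loop, closed up along fixed paths to the base
    vertex, is the image under [psi] of the value of the cocycle, then the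
    class of any loop is the image of its holonomy.  This is proved by
    following the loop for a short time and then running straight to a vertex
    of the simplex that has been reached. *)
Section LoopsFromHolonomy.
Variables (R : realType) (V : finType) (K : {set {set V}}).
Hypothesis Kcplx : is_complex K.
Local Notation I := (unit_interval R).
Variables (G : groupType) (g : V -> V -> G).
Variable b : V.
Local Notation vx := (vertex R Kcplx).
Variable beta : forall v, {path I from vx b to vx v}.
Hypothesis beta_base : path_homotopic (beta b) (const_path R (vx b)).
Variable psi : G -> pi1 R (vx b).
Hypothesis psiM : {morph psi : a c / (a * c)%g}.
Hypothesis psi_edge : forall u v (uv : joined (vx u) (vx v)),
  loop_class (concat (beta u) (concat (segment Kcplx uv) (reverse (beta v)))) =
  psi (g u v).

Lemma loop_class_holonomy (p : {path I from vx b to vx b}) a :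
  holonomy (point_cocycle Kcplx g) p a -> loop_class p = psi a.
Proof.
case=> h [[e e0 hP] h0 h1].
have cp : continuous p by exact: cts_fun.
have pb : p (clamp 0) = vx b by rewrite clamp_le0 // path_zero.
have large_b : large_coordinate Kcplx (vx b) = b by exact: large_coordinate_vertex.
have [f f0 fP] := path_uniformly_close (@close_local R V K) cp.
pose P r := forall y m (py : p (clamp r) = y) (my : large_coordinate Kcplx y = m)
  (ym : joined y (vx m)),
  loop_class (concat (subpath cp pb py)
    (concat (segment Kcplx ym) (reverse (beta m)))) = psi (h (clamp r)).
have : P 1.
  apply: (@interval_induction R P (Num.min e f)).
  - by rewrite lt_min e0.
  - move=> y m py my; have y_eq : y = vx b by rewrite -py.
    move: py my; rewrite {}y_eq large_b => py <- ym.
    rewrite clamp_le0 // h0 (morph_one psiM); apply/loop_classP.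
    have -> : path_homotopic (subpath cp pb py) (const_path R (vx b)).
      apply: path_homotopic_eq => s.
      rewrite -[LHS]/(p (affine_param 0 0 s)) /affine_param subrr mulr0 addr0.
      by rewrite pb.
    by rewrite segment_refl !concat1_homotopic beta_base reverse_const_path.
  - move=> r r' r0 rr' r'1; rewrite lt_min => /andP[re rf] IH y' m' py' my' ym'.
    have cr : coord (clamp r) = r by rewrite coord_clamp_id; lra.
    have cr' : coord (clamp r') = r' by rewrite coord_clamp_id; lra.
    have [y py] : exists y, p (clamp r) = y by exists (p (clamp r)).
    have [m my] : exists m, large_coordinate Kcplx y = m.
      by exists (large_coordinate Kcplx y).
    have my_supp : m \in supp (bary y).
      rewrite -my; apply: large_coordinate_supp.
      exact: (close_refl (@close_local R V K)).
    have ym : joined y (vx m) by exact: joined_vertex.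
    have := IH y m py my ym => {}IH.
    pose S0 (s : I) := p (affine_param r r' s).
    have cS0 s : coord (affine_param r r' s) = r + coord s * (r' - r).
      have s0 := coord_ge0 s; have s1 := coord_le1 s.
      rewrite /affine_param coord_clamp_id //; apply/andP; split; nra.
    have mS0 s : m \in supp (bary (S0 s)).
      rewrite -my -py; apply: large_coordinate_supp; apply: fP.
      rewrite cS0 cr; have s0 := coord_ge0 s; have s1 := coord_le1 s.
      by rewrite ltr_norml; apply/andP; split; nra.
    have m'S0 s : m' \in supp (bary (S0 s)).
      rewrite -my' -py'; apply: large_coordinate_supp; apply: fP.
      rewrite cS0 cr'; have s0 := coord_ge0 s; have s1 := coord_le1 s.
      by rewrite ltr_norml; apply/andP; split; nra.
    have mm' : joined (vx m) (vx m').
      apply: (@joined_simplex _ _ _ Kcplx _ _ (supp (bary (S0 zero)))).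
      + exact: supp_bary.
      + by rewrite supp_vertex finset.sub1set.
      + by rewrite supp_vertex finset.sub1set.
    have S0mm' s : joined (S0 s) (mix Kcplx mm' s).
      apply: (@joined_simplex _ _ _ Kcplx _ _ (supp (bary (S0 s)))) => //.
        exact: supp_bary.
      apply: (fintype.subset_trans (supp_mix Kcplx mm' s)).
      by rewrite !supp_vertex finset.subUset !finset.sub1set mS0 m'S0.
    have square : path_homotopic
        (concat (subpath cp py py') (segment Kcplx ym'))
        (concat (segment Kcplx ym) (segment Kcplx mm')).
      apply: (@square_homotopic _ _
        (fun st => mix Kcplx (S0mm' st.1) st.2)).
      + apply: (@continuous_mix _ _ _ Kcplx _ (S0 \o fst) (mix Kcplx mm' \o fst)
          (fun st => S0mm' st.1) snd).
        * apply: (@continuous_comp_all _ _ _ fst S0).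
            apply: continuous_comp_all => //; exact: continuous_affine_param.
          exact: continuous_fst_all.
        * apply: continuous_comp_all; first exact: continuous_segment.
          exact: continuous_fst_all.
        * exact: continuous_snd_all.
      + by move=> s; rewrite mix0.
      + by move=> s; rewrite mix1.
      + move=> t; apply: bary_inj => v.
        rewrite -[LHS]/(bary (mix Kcplx ym t) v) -[RHS]/(bary (mix Kcplx (S0mm' zero) t) v).
        by rewrite !bary_mix coord0 subr0 mul1r mul0r addr0 /S0 affine_param0 py.
      + move=> t; apply: bary_inj => v.
        rewrite -[LHS]/(bary (mix Kcplx ym' t) v) -[RHS]/(bary (mix Kcplx (S0mm' one) t) v).
        by rewrite !bary_mix coord1 subrr mul0r add0r mul1r /S0 affine_param1 py'.
    rewrite (hP (clamp r)); last by rewrite cr cr' ltr_norml; lra.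
    rewrite psiM -IH py py' /point_cocycle my my' -(psi_edge mm') -loop_classM.
    apply/loop_classP.
    rewrite -(subpath_concat cp pb py py') -!concatA_homotopic.
    rewrite concatKV_homotopic (concatA_homotopic (subpath cp py py')) square.
    by rewrite -!concatA_homotopic.
  - by rewrite ler01 lexx.
have p1 : p (clamp 1) = vx b by rewrite clamp_ge1 // path_one.
have bb : joined (vx b) (vx b) by exact: joined_refl.
move=> /(_ _ _ p1 large_b bb); rewrite clamp_ge1 // h1 => <-.
apply/loop_classP; rewrite segment_refl concat1_homotopic.
have -> : path_homotopic (subpath cp pb p1) p.
  apply: path_homotopic_eq => s.
  by rewrite -[LHS]/(p (affine_param 0 1 s)) /affine_param subr0 mulr1 add0r coordK.
by rewrite beta_base reverse_const_path concatp1_homotopic.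
Qed.

End LoopsFromHolonomy.

(** * The fundamental group of the complete graph on four vertices *)

Section CompleteGraph.
Variable V : finType.

Definition complete_graph : {set {set V}} :=
  [set s : {set V} | 0 < #|s| <= 2]%N%SET.

Lemma complete_graph_complex : is_complex complete_graph.
Proof.
split=> [|s s'|v]; rewrite ?inE ?cards0 ?cards1 //.
move=> /andP[_ s2] s's s'0; rewrite card_gt0 s'0.
exact: leq_trans (subset_leq_card s's) s2.
Qed.

Lemma edge_complete_graph u v : [set u; v]%SET \in complete_graph.
Proof. by rewrite inE cards2; case: eqP. Qed.

Lemma complete_graph_pigeonhole (s : {set V}) u v w : s \in complete_graph ->
  u \in s -> v \in s -> w \in s -> [\/ u = v, v = w | u = w].
Proof.
rewrite inE => /andP[_ s2] us vs ws.
have [->|uv] := eqVneq u v; first exact: Or31.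
have [->|vw] := eqVneq v w; first exact: Or32.
have [->|uw] := eqVneq u w; first exact: Or33.
have : (#|[set u; v; w]%SET| <= 2)%N.
  apply: leq_trans s2; apply: subset_leq_card.
  by rewrite !finset.subUset !finset.sub1set us vs ws.
have -> : [set u; v; w]%SET = (w |: [set u; v])%SET by rewrite finset.setUC.
by rewrite cardsU1 cards2 !inE (eq_sym w u) (eq_sym w v) negb_or uw vw uv.
Qed.

Lemma weights_pair (R : realType) (w : V -> R) u v : (forall x, 0 <= w x) ->
  supp w \subset [set u; v]%SET -> 0 < w u + w v -> weights complete_graph w.
Proof.
move=> w0 ws wuv; split=> //; have [_ Kdown _] := complete_graph_complex.
apply: (Kdown _ _ (edge_complete_graph u v)) => //.
apply/eqP => s0; have z x : w x = 0.
  by apply/eqP; apply: contraT => wx; have := finset.in_set0 x; rewrite -s0 inE wx.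
by move: wuv; rewrite !z addr0 ltxx.
Qed.

End CompleteGraph.

(** The complete graph on four vertices is seen as a wheel with hub [None]
    and rim [Some 0 -> Some 1 -> Some 2 -> Some 0]; collapsing the three
    spokes leaves one free generator for each edge of the rim. *)
Section Wheel.
Variable R : realType.
Local Notation I := (unit_interval R).
Local Notation K := (complete_graph (option 'I_3)).
Local Notation Kcplx := (complete_graph_complex (option 'I_3)).
Local Notation vx := (vertex R Kcplx).
Local Notation F3 := (free_group 'I_3).
Local Open Scope group_scope.

Definition wheel_cocycle (u v : option 'I_3) : F3 :=
  if (u, v) is (Some i, Some j) then
    if j == (i + 1)%R then free_gen i
    else if i == (j + 1)%R then (free_gen j)^-1 else 1
  else 1.

Lemma ord3_succ_neq (i : 'I_3) : (i == i + 1)%R = false.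
Proof. by case: i => -[|[|[|]]]. Qed.

Lemma ord3_succ2_neq (i : 'I_3) : (i == i + 1 + 1)%R = false.
Proof. by case: i => -[|[|[|]]]. Qed.

Lemma ord3_cases (i j : 'I_3) : [\/ i = j, j = (i + 1)%R | i = (j + 1)%R].
Proof.
by case: i j => -[|[|[|]]] // ? [[|[|[|]]] // ?];
  do ?[by apply: Or31; exact: val_inj | by apply: Or32; exact: val_inj
      | by apply: Or33; exact: val_inj].
Qed.

Lemma wheel_cocycle_refl u : wheel_cocycle u u = 1.
Proof. by case: u => [i|] //; rewrite /wheel_cocycle ord3_succ_neq. Qed.

Lemma wheel_cocycle_sym u v : wheel_cocycle u v * wheel_cocycle v u = 1.
Proof.
case: u v => [i|] [j|]; rewrite ?mulg1 //.
have [->|->|->] := ord3_cases i j; rewrite ?wheel_cocycle_refl ?mulg1 //.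
  by rewrite /wheel_cocycle eqxx ord3_succ2_neq mulgV.
by rewrite /wheel_cocycle eqxx ord3_succ2_neq mulVg.
Qed.

Lemma wheel_cocycleM (s : {set option 'I_3}) u v w : s \in K ->
  u \in s -> v \in s -> w \in s ->
  wheel_cocycle u v * wheel_cocycle v w = wheel_cocycle u w.
Proof.
move=> sK us vs ws; have [->|->|->] := complete_graph_pigeonhole sK us vs ws.
- by rewrite wheel_cocycle_refl mul1g.
- by rewrite wheel_cocycle_refl mulg1.
- by rewrite wheel_cocycle_sym wheel_cocycle_refl.
Qed.

Lemma joined_wheel u v : joined (vx u) (vx v).
Proof. by apply: joined_vertices; exact: edge_complete_graph. Qed.

Definition wheel_edge u v : {path I from vx u to vx v} :=
  segment Kcplx (joined_wheel u v).

Lemma wheel_edge_refl u : path_homotopic (wheel_edge u u) (const_path R (vx u)).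
Proof. exact: segment_refl. Qed.

Lemma wheel_edge_reverse u v :
  path_homotopic (reverse (wheel_edge u v)) (wheel_edge v u).
Proof. exact: segment_reverse. Qed.

Definition hub_loop u v : {path I from vx None to vx None} :=
  concat (wheel_edge None u)
    (concat (wheel_edge u v) (reverse (wheel_edge None v))).

Lemma hub_loop_sym u v :
  loop_class (hub_loop u v) * loop_class (hub_loop v u) = 1.
Proof.
rewrite -loop_classM; apply/loop_classP; rewrite /hub_loop -!concatA_homotopic.
rewrite concatKV_homotopic -(wheel_edge_reverse u v) concatVK_homotopic.
exact: concat_reverse_homotopic.
Qed.

Lemma hub_loop_hub v : loop_class (hub_loop None v) = 1.
Proof.
apply/loop_classP; rewrite /hub_loop wheel_edge_refl concat1_homotopic.
exact: concat_reverse_homotopic.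
Qed.

Lemma hub_loop_refl u : loop_class (hub_loop u u) = 1.
Proof.
apply/loop_classP; rewrite /hub_loop wheel_edge_refl concat1_homotopic.
exact: concat_reverse_homotopic.
Qed.

Definition rim_loop (i : 'I_3) : pi1 R (vx None) :=
  loop_class (hub_loop (Some i) (Some (i + 1)%R)).

(** The loop through an edge is trivial unless the edge lies on the rim. *)
Lemma hub_loop_lift u v :
  loop_class (hub_loop u v) = free_lift rim_loop (wheel_cocycle u v).
Proof.
have lift1 : free_lift rim_loop 1 = 1 by exact: morph_one (free_liftM _).
have liftV i : free_lift rim_loop (free_gen i)^-1 = (rim_loop i)^-1.
  apply: (mulgI (rim_loop i)); rewrite mulgV -{1}(free_lift_gen rim_loop i).
  by rewrite -free_liftM mulgV.
case: u v => [i|] [j|]; rewrite ?hub_loop_hub //=.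
- rewrite /wheel_cocycle; have [->|->|->] := ord3_cases i j.
  + by rewrite ord3_succ_neq hub_loop_refl lift1.
  + by rewrite eqxx free_lift_gen.
  + rewrite ord3_succ2_neq eqxx liftV; apply: (mulgI (rim_loop j)).
    by rewrite mulgV; exact: hub_loop_sym.
- have := hub_loop_sym (Some i) None; rewrite hub_loop_hub mulg1 => ->.
  by rewrite /wheel_cocycle lift1.
Qed.

Local Notation hol := (holonomy (point_cocycle (R := R) Kcplx wheel_cocycle)).

Lemma wheel_cocycle_local : forall x y z : polyhedron R K,
  close x y -> close y z -> close x z ->
  point_cocycle Kcplx wheel_cocycle x y * point_cocycle Kcplx wheel_cocycle y z
  = point_cocycle Kcplx wheel_cocycle x z.
Proof. exact: point_cocycleM wheel_cocycleM. Qed.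

Lemma holonomy_hub_loop u v : hol (hub_loop u v) (wheel_cocycle u v).
Proof.
have edge x y : hol (wheel_edge x y) (wheel_cocycle x y).
  exact: holonomy_segment wheel_cocycleM _ _ _.
have concatM := holonomy_concat (@close_local R _ K) wheel_cocycle_local.
have rev : hol (reverse (wheel_edge None v)) (wheel_cocycle v None).
  apply: (holonomy_homotopic (@close_local R _ K) wheel_cocycle_local).
    exact: path_homotopic_sym (wheel_edge_reverse None v).
  exact: edge.
have := concatM _ _ _ _ _ _ _ _ (edge None u)
  (concatM _ _ _ _ _ _ _ _ (edge u v) rev).
have -> : wheel_cocycle v None = 1 by case: (v).
by rewrite mul1g mulg1.
Qed.

Lemma holonomy_class_exists (c : pi1 R (vx None)) :
  exists a, forall p, c = loop_class p -> hol p a.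
Proof.
elim/pi1_ind: c => p.
have cp : continuous p by exact: cts_fun.
have [a pa] := holonomy_exists (@close_local R _ K) wheel_cocycle_local cp.
exists a => q /loop_classP pq.
exact: (holonomy_homotopic (@close_local R _ K) wheel_cocycle_local pq pa).
Qed.

(** The holonomy and the free lift of the rim loops are inverse to each other:
    one composite is the expression of a loop by its holonomy, the other is
    evaluated on generators. *)
Lemma pi1_wheel : group_isomorphic (pi1 R (vx None)) F3.
Proof.
have [Phi PhiP] := choice holonomy_class_exists.
have PhiE (p : {path I from vx None to vx None}) a : hol p a -> Phi (loop_class p) = a.
  by move=> pa; exact: holonomy_unique (PhiP _ p erefl) pa.
have PhiM : {morph Phi : c c' / c * c'}.
  elim/pi1_ind => p; elim/pi1_ind => q; rewrite -loop_classM; apply: PhiE.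
  by apply: (holonomy_concat (@close_local R _ K) wheel_cocycle_local);
    exact: PhiP.
apply: (group_isomorphic_bij PhiM); exists (free_lift rim_loop).
  elim/pi1_ind => p.
  apply/esym.
  apply: (loop_class_holonomy (g := wheel_cocycle) (beta := wheel_edge None)).
  - exact: wheel_edge_refl.
  - exact: free_liftM.
  - move=> u v uv; rewrite -hub_loop_lift; apply/loop_classP.
    rewrite /hub_loop; have -> // : path_homotopic (segment Kcplx uv) (wheel_edge u v).
    by apply: path_homotopic_eq => t; exact: bary_inj.
  - exact: PhiP.
have PhiLift : {morph Phi \o free_lift rim_loop : w w' / w * w'}.
  by move=> w w'; rewrite /= free_liftM PhiM.
move=> w; rewrite -[LHS]/((Phi \o free_lift rim_loop) w).
rewrite (free_lift_unique PhiLift) [RHS](@free_lift_unique _ _ id) //.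
congr (free_lift _ w); apply/funext => i /=.
rewrite free_lift_gen; apply: PhiE; have := holonomy_hub_loop (Some i) (Some (i + 1)%R).
by rewrite /wheel_cocycle eqxx.
Qed.

Lemma wheel_connected (x : polyhedron R K) :
  exists _ : {path I from vx None to x}, True.
Proof.
have := supp_bary x; rewrite inE card_gt0 => /andP[/finset.set0Pn[v vx'] _].
have vx_x : joined (vx v) x.
  by have := joined_vertex Kcplx vx'; rewrite /joined finset.setUC.
by exists (concat (wheel_edge None v) (segment Kcplx vx_x)).
Qed.

End Wheel.

(** * The circle and maps into a wedge *)

Section Circle.
Variable R : realType.
Local Notation C := (set_type (circle R)).

Definition circle_x (c : C) : R := (set_val c).1.
Definition circle_y (c : C) : R := (set_val c).2.

Lemma circleE (c : C) : circle_x c ^+ 2 + circle_y c ^+ 2 = 1.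
Proof. exact: (set_mem (valP c)). Qed.

Lemma circle_inj (c d : C) :
  circle_x c = circle_x d -> circle_y c = circle_y d -> c = d.
Proof.
case: c d => [[x y] ?] [[x' y'] ?]; rewrite /circle_x /circle_y !set_valE /=.
by move=> xx' yy'; apply: val_inj; rewrite /= xx' yy'.
Qed.

Lemma continuous_circle_x : continuous circle_x.
Proof.
apply: (@continuous_comp_all _ _ _ (set_val : C -> R * R) fst).
  exact: continuous_fst_all.
exact: continuous_set_val.
Qed.

Lemma continuous_circle_y : continuous circle_y.
Proof.
apply: (@continuous_comp_all _ _ _ (set_val : C -> R * R) snd).
  exact: continuous_snd_all.
exact: continuous_set_val.
Qed.

Lemma direction_subproof (a b : R) : a ^+ 2 + b ^+ 2 != 0 ->
  (a / Num.sqrt (a ^+ 2 + b ^+ 2), b / Num.sqrt (a ^+ 2 + b ^+ 2)) \in circle R.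
Proof.
move=> ab; apply/mem_set; rewrite /circle /= !exprMn exprVn sqr_sqrtr.
  by rewrite -mulrDl divff.
by rewrite addr_ge0 ?sqr_ge0.
Qed.

Definition direction (a b : R) (ab : a ^+ 2 + b ^+ 2 != 0) : C :=
  exist (fun p : R * R => p \in circle R) _ (direction_subproof ab).

Section Direction.
Variables (a b : R) (ab : a ^+ 2 + b ^+ 2 != 0).

Definition modulus := Num.sqrt (a ^+ 2 + b ^+ 2).

Lemma modulus_gt0 : 0 < modulus.
Proof. by rewrite sqrtr_gt0 lt_def ab addr_ge0 ?sqr_ge0. Qed.

Lemma direction_x : circle_x (direction ab) = a / modulus.
Proof. by []. Qed.

Lemma direction_y : circle_y (direction ab) = b / modulus.
Proof. by []. Qed.

End Direction.

Lemma direction_circle (a b : R) (ab : a ^+ 2 + b ^+ 2 != 0) (c : C) :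
  a = circle_x c -> b = circle_y c -> direction ab = c.
Proof.
move=> ac bc; have n1 : modulus a b = 1.
  by rewrite /modulus ac bc circleE sqrtr1.
by apply: circle_inj; rewrite ?direction_x ?direction_y n1 divr1.
Qed.

Lemma continuous_direction (Z : topologicalType) (a b : Z -> R)
    (ab : forall z, a z ^+ 2 + b z ^+ 2 != 0) :
  continuous a -> continuous b -> continuous (fun z => direction (ab z)).
Proof.
move=> ca cb; apply: continuous_into_subset.
have cn : continuous (fun z => (modulus (a z) (b z))^-1).
  apply: continuousV_all => [z|]; first by rewrite gt_eqF // modulus_gt0.
  apply: continuous_sqrt_all; apply: continuousD_all.
    rewrite (_ : (fun _ => _) = fun z => a z * a z); first exact: continuousM_all.
    by apply/funext => z; rewrite expr2.
  rewrite (_ : (fun _ => _) = fun z => b z * b z); first exact: continuousM_all.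
  by apply/funext => z; rewrite expr2.
by apply: continuous_pair; apply: continuousM_all.
Qed.

(** A segment between two points of the circle avoids the origin unless they
    are antipodal. *)
Lemma circle_segment_neq0 (c d : C) (t : unit_interval R) :
  (circle_x c + circle_x d != 0) || (circle_y c + circle_y d != 0) ->
  ((1 - coord t) * circle_x c + coord t * circle_x d) ^+ 2 +
  ((1 - coord t) * circle_y c + coord t * circle_y d) ^+ 2 != 0.
Proof.
move=> cd; rewrite paddr_eq0 ?sqr_ge0 // !sqrf_eq0; apply/negP.
have := circleE c; have := circleE d; move: cd (coord_ge0 t) (coord_le1 t).
move: (circle_x c) (circle_y c) (circle_x d) (circle_y d) (coord t).
move=> x y x' y' s cd s0 s1 d1 c1 /andP[/eqP xs /eqP ys].
(* The squared moduli of (1 - s) * c and s * d agree, so s = 1/2. *)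
have s2 : s = 2^-1.
  have : (1 - s) ^+ 2 * (x ^+ 2 + y ^+ 2) = s ^+ 2 * (x' ^+ 2 + y' ^+ 2).
    have xs' : (1 - s) * x = - (s * x') by lra.
    have ys' : (1 - s) * y = - (s * y') by lra.
    by rewrite !mulrDr -!exprMn xs' ys' !sqrrN.
  by rewrite c1 d1; lra.
move: xs ys cd; rewrite s2 => xs ys.
have -> : x + x' = 0 by lra.
have -> : y + y' = 0 by lra.
by rewrite eqxx.
Qed.

Lemma circle_base_closed : closed [set circle_base R].
Proof.
have -> : [set circle_base R] = circle_x @^-1` [set 1].
  apply/seteqP; split=> c /=; first by move->.
  move=> x1; apply: circle_inj; first by rewrite x1.
  by have := circleE c; rewrite x1 /circle_y /=; nra.
move: continuous_circle_x => /continuous_closedP; apply.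
exact: closed_eq.
Qed.

End Circle.

Section WedgeMaps.
Variables (J : choiceType) (X : J -> topologicalType) (p0 : forall j, X j).
Hypothesis J_finite : finite_set [set: J].
Hypothesis p0_closed : forall j, closed [set p0 j].

(** A finite wedge embeds into the product of its summands. *)
Lemma continuous_into_wedge (Z : topologicalType) (f : Z -> wedge p0) :
  (forall j, continuous (fun z => wedge_prod (f z) j)) -> continuous f.
Proof.
move=> cf; have {}cf : continuous (@wedge_prod _ _ p0 \o f).
  exact: continuous_into_product.
move=> z A /(wedge_prod_open J_finite p0_closed).
move=> /nbhs_subspace_ex[]; first by exists (f z).
move=> U Uz UA; have := cf z U Uz; rewrite /= !nbhs_simpl /=.
apply: filterS => t Ut.
have : (U `&` range (@wedge_prod _ _ p0)) (wedge_prod (f t)).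
  by split=> //; exists (f t).
rewrite -UA => -[[w Aw /wedge_prod_inj wt] _].
by rewrite /= -wt.
Qed.

Lemma wedge_prod_lift j (x : X j) : wedge_prod (wedge_lift p0 x) = dfwith p0 j x.
Proof. by rewrite /wedge_prod wedge_lift_funE //; exact: wedge_prod_pointE. Qed.

Lemma wedge_ind (P : wedge p0 -> Prop) :
  (forall j (x : X j), P (wedge_lift p0 x)) -> forall w, P w.
Proof.
move=> HP w; have : (\bigcup_j (@wedge_lift _ _ p0 j) @` setT) w.
  by rewrite wedgeTE.
by case=> j _ [x _ <-].
Qed.

End WedgeMaps.

(** * Collapsing the spokes of the wheel *)

Section WheelWedge.
Variable R : realType.
Local Notation K := (complete_graph (option 'I_3)).
Local Notation Kcplx := (complete_graph_complex (option 'I_3)).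
Local Notation Y := (polyhedron R K).
Local Notation vx := (vertex R Kcplx).
Local Notation C := (set_type (circle R)).
Local Notation base := (circle_base R).
Local Notation W := (circle_wedge R 3).
Local Notation pt := (fun _ : 'I_3 => circle_base R).
Implicit Types (y : Y) (k : 'I_3) (c : C).

Lemma base_x : circle_x base = 1. Proof. by []. Qed.

Lemma base_y : circle_y base = 0. Proof. by []. Qed.

Lemma ord3_finite : finite_set [set: 'I_3].
Proof. exact: finite_finset. Qed.

Lemma pt_closed : forall k, closed [set pt k].
Proof. by move=> k; exact: circle_base_closed. Qed.

Variant wheel_edge_spec (y : Y) : Prop :=
| OnSpoke (k : 'I_3) (_ : supp (bary y) \subset [set None; Some k]%SET)
| OnRim (k : 'I_3) (_ : supp (bary y) \subset [set Some k; Some (k + 1)]%SET).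

Lemma wheel_edgeP y : wheel_edge_spec y.
Proof.
have [u [v ys]] : exists u v, supp (bary y) \subset [set u; v]%SET.
  have := supp_bary y; rewrite inE => /andP[y0].
  rewrite leq_eqVlt ltnS => /orP[/cards2P[u [v [_ ->]]]|y1]; first by exists u, v.
  have /cards1P[v ->] : #|supp (bary y)| == 1%N by rewrite eqn_leq y1.
  by exists v, v; rewrite finset.setUid.
have spoke k : {subset [set u; v]%SET <= [set None; Some k]%SET} ->
    wheel_edge_spec y.
  move=> uvk; apply: (@OnSpoke _ k); apply: (fintype.subset_trans ys).
  exact/fintype.subsetP.
have rim k : {subset [set u; v]%SET <= [set Some k; Some (k + 1)]%SET} ->
    wheel_edge_spec y.
  move=> uvk; apply: (@OnRim _ k); apply: (fintype.subset_trans ys).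
  exact/fintype.subsetP.
case: u v {ys} spoke rim => [i|] [j|] spoke rim.
- have [ij|ij|ij] := ord3_cases i j.
  + by apply: (spoke i) => x; rewrite !inE ij orbb => ->; rewrite orbT.
  + by apply: (rim i) => x; rewrite !inE ij.
  + by apply: (rim j) => x; rewrite !inE ij orbC.
- by apply: (spoke i) => x; rewrite !inE orbC.
- by apply: (spoke j) => x; rewrite !inE.
- by apply: (spoke ord0) => x; rewrite !inE orbb => ->.
Qed.

Definition rim_prod (y : Y) (k : 'I_3) : R :=
  bary y (Some k) * bary y (Some (k + 1)).

Lemma rim_prod_spoke y k : supp (bary y) \subset [set None; Some k]%SET ->
  forall j, rim_prod y j = 0.
Proof.
move=> ys j; rewrite /rim_prod; have [->|jk] := eqVneq j k.
  rewrite [X in _ * X](bary_outside ys) ?mulr0 // !inE /=.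
  by rewrite (inj_eq Some_inj) eq_sym ord3_succ_neq.
by rewrite (bary_outside ys) ?mul0r // !inE /= (inj_eq Some_inj).
Qed.

Lemma rim_prod_rim y k j :
  supp (bary y) \subset [set Some k; Some (k + 1)]%SET -> j != k ->
  rim_prod y j = 0.
Proof.
move=> ys jk; rewrite /rim_prod; have [->|jk1] := eqVneq j (k + 1).
  rewrite [X in _ * X](bary_outside ys) ?mulr0 // !inE !(inj_eq Some_inj).
  by rewrite eq_sym ord3_succ2_neq eq_sym ord3_succ_neq.
by rewrite (bary_outside ys) ?mul0r // !inE !(inj_eq Some_inj) negb_or jk.
Qed.

Lemma rim_sum y k : supp (bary y) \subset [set Some k; Some (k + 1)]%SET ->
  bary y (Some k) + bary y (Some (k + 1)) = 1.
Proof. by apply: bary_pair; rewrite (inj_eq Some_inj) ord3_succ_neq. Qed.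

Lemma rim_sum_prod y k : rim_prod y k != 0 ->
  bary y (Some k) + bary y (Some (k + 1)) = 1.
Proof.
case: (wheel_edgeP y) => j ys; first by rewrite (rim_prod_spoke ys) eqxx.
have [->|kj] := eqVneq k j; first by rewrite (rim_sum ys).
by rewrite (rim_prod_rim ys kj) eqxx.
Qed.

(** As [u] goes from 1 to 0 with [u + v = 1], the point
    [(1 - 6uv, uv(u - v))] describes a closed curve around the origin, based
    at [(1, 0)]; off the edge from [k] to [k + 1] it stays at [(1, 0)]. *)
Definition rim_curve_x y k : R := 1 - 6 * rim_prod y k.

Definition rim_curve_y y k : R :=
  rim_prod y k * (bary y (Some k) - bary y (Some (k + 1))).

Lemma rim_curve_neq0 y k : rim_curve_x y k ^+ 2 + rim_curve_y y k ^+ 2 != 0.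
Proof.
rewrite paddr_eq0 ?sqr_ge0 // !sqrf_eq0 mulf_eq0 !subr_eq0; apply/negP.
case/andP=> /eqP x0 /orP[/eqP p0|/eqP uv].
  by move: x0; rewrite p0 mulr0 => /esym/eqP; rewrite eq_sym oner_eq0.
have p0 : rim_prod y k != 0.
  apply/eqP => p0; move: x0; rewrite p0 mulr0 => /eqP.
  by rewrite oner_eq0.
have := rim_sum_prod p0; move: x0; rewrite /rim_prod uv; nra.
Qed.

Definition rim_circle y k : C := direction (rim_curve_neq0 y k).

Lemma rim_circle_base y k : rim_prod y k = 0 -> rim_circle y k = base.
Proof.
by move=> p0; apply: direction_circle;
  rewrite ?base_x ?base_y /rim_curve_x /rim_curve_y p0 ?mulr0 ?mul0r ?subr0.
Qed.

(** A point lies inside at most one edge of the rim, and it goes to the circle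
    of this edge; the spokes go to the wedge point. *)
Definition wheel_to_wedge (y : Y) : W :=
  if [pick k | rim_prod y k != 0] is Some k
  then wedge_lift pt (i := k) (rim_circle y k)
  else wedge_lift pt (i := ord0) base.

Lemma wedge_prod_wheel y k : wedge_prod (wheel_to_wedge y) k = rim_circle y k.
Proof.
rewrite /wheel_to_wedge; case: pickP => [j pj|p0]; rewrite wedge_prod_lift.
  case: (dfwithP pt (rim_circle y j) k) => // i ij.
  case: (wheel_edgeP y) => l ys; first by rewrite (rim_prod_spoke ys) eqxx in pj.
  have jl : j = l by apply: contra_eq _ (erefl : rim_prod y j = rim_prod y j);
    move=> jl; rewrite (rim_prod_rim ys jl) eqxx in pj.
  by rewrite rim_circle_base // (rim_prod_rim ys) // -jl eq_sym.
rewrite rim_circle_base; last by apply/eqP; have := p0 k => /negbFE.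
by case: (dfwithP pt base k).
Qed.

Lemma wheel_to_wedge_eq y k (c : C) :
  (forall j, j != k -> rim_circle y j = base) -> rim_circle y k = c ->
  wheel_to_wedge y = wedge_lift pt (i := k) c.
Proof.
move=> yj yk; apply: wedge_prod_inj; apply/functional_extensionality_dep => j.
rewrite wedge_prod_wheel wedge_prod_lift; case: dfwithP => // i ki.
by apply: yj; rewrite eq_sym.
Qed.

Lemma continuous_wheel_to_wedge : continuous wheel_to_wedge.
Proof.
apply: (continuous_into_wedge ord3_finite pt_closed) => k.
rewrite (_ : (fun _ => _) = fun y => rim_circle y k); last first.
  by apply/funext => y; exact: wedge_prod_wheel.
have cb v : continuous (fun y : Y => bary y v) by exact: continuous_bary.
have cp : continuous (fun y : Y => rim_prod y k) by exact: continuousM_all.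
apply: continuous_direction.
  apply: continuousB_all; first exact: continuous_cst_all.
  by apply: continuousM_all => //; exact: continuous_cst_all.
by apply: continuousM_all => //; exact: continuousB_all.
Qed.

(** The circle with index [k] runs from the hub to [k], along the rim to
    [k + 1] and back to the hub. *)
Definition circle_weight (k : 'I_3) (c : C) (v : option 'I_3) : R :=
  let x := circle_x c in let y := circle_y c in
  if v is Some j then
    (j == k)%:R * (Num.max 0 y + Num.max 0 (- x)) +
    (j == k + 1)%:R * (Num.max 0 (- y) + Num.max 0 (- x))
  else Num.max 0 x.

Lemma circle_weight_ge0 k c v : 0 <= circle_weight k c v.
Proof.
have m (x : R) : 0 <= Num.max 0 x by rewrite le_max lexx.
by case: v => [j|] //=; rewrite addr_ge0 // mulr_ge0 ?addr_ge0 // ler0n.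
Qed.

Lemma circle_weight_k k c : circle_weight k c (Some k) =
  Num.max 0 (circle_y c) + Num.max 0 (- circle_x c).
Proof. by rewrite /= eqxx ord3_succ_neq mul1r mul0r addr0. Qed.

Lemma circle_weight_k1 k c : circle_weight k c (Some (k + 1)) =
  Num.max 0 (- circle_y c) + Num.max 0 (- circle_x c).
Proof. by rewrite /= eqxx eq_sym ord3_succ_neq mul1r mul0r add0r. Qed.

Lemma circle_weight_other k c j : j != k -> j != k + 1 ->
  circle_weight k c (Some j) = 0.
Proof. by move=> /negbTE jk /negbTE jk1; rewrite /= jk jk1 !mul0r addr0. Qed.

Lemma supp_circle_upper k c : 0 <= circle_x c -> 0 <= circle_y c ->
  supp (circle_weight k c) \subset [set None; Some k]%SET.
Proof.
move=> x0 y0; apply/fintype.subsetP => -[j|]; rewrite !inE //=.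
rewrite (inj_eq Some_inj); apply: contraNT => /negbTE->.
have -> : Num.max 0 (- circle_x c) = 0 by rewrite max_l ?oppr_le0.
have -> : Num.max 0 (- circle_y c) = 0 by rewrite max_l ?oppr_le0.
by rewrite !addr0 mul0r mulr0 addr0.
Qed.

Lemma supp_circle_lower k c : 0 <= circle_x c -> circle_y c <= 0 ->
  supp (circle_weight k c) \subset [set None; Some (k + 1)]%SET.
Proof.
move=> x0 y0; apply/fintype.subsetP => -[j|]; rewrite !inE //=.
rewrite (inj_eq Some_inj); apply: contraNT => /negbTE->.
have -> : Num.max 0 (- circle_x c) = 0 by rewrite max_l ?oppr_le0.
by rewrite (max_l y0) !addr0 mul0r mulr0 addr0.
Qed.

Lemma supp_circle_left k c : circle_x c <= 0 ->
  supp (circle_weight k c) \subset [set Some k; Some (k + 1)]%SET.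
Proof.
move=> x0; apply/fintype.subsetP => -[j|]; rewrite !inE.
  rewrite !(inj_eq Some_inj); apply: contraNT; rewrite negb_or => /andP[jk jk1].
  by rewrite circle_weight_other.
by rewrite /= max_l // eqxx.
Qed.

Lemma circle_weightP k c : weights K (circle_weight k c).
Proof.
have w0 := circle_weight_ge0 k c; have cE := circleE c.
have mE (x : R) : 0 <= x -> Num.max 0 x = x by move=> x0; rewrite max_r.
have m0 (x : R) : 0 <= Num.max 0 x by rewrite le_max lexx.
have [x0|x0] := leP (circle_x c) 0.
  apply: (weights_pair w0 (supp_circle_left k x0)).
  rewrite circle_weight_k circle_weight_k1.
  have m1 := m0 (- circle_x c).
  have {m1}-> : Num.max 0 (- circle_x c) = - circle_x c by rewrite mE ?oppr_ge0.
  case/orP: (le_total 0 (circle_y c)) => y0.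
    by rewrite (mE _ y0); have := m0 (- circle_y c); nra.
  rewrite (mE (- circle_y c)) ?oppr_ge0 //; have := m0 (circle_y c).
  nra.
have [y0|y0] := leP 0 (circle_y c).
  apply: (weights_pair w0 (supp_circle_upper k (ltW x0) y0)).
  by apply: ltr_pwDl; [rewrite /= lt_max x0 orbT | exact: w0].
apply: (weights_pair w0 (supp_circle_lower k (ltW x0) (ltW y0))).
by apply: ltr_pwDl; [rewrite /= lt_max x0 orbT | exact: w0].
Qed.

Definition circle_to_wheel (k : 'I_3) (c : C) : Y :=
  normalize Kcplx (circle_weightP k c).

Lemma circle_to_wheel_base k : circle_to_wheel k base = vx None.
Proof.
apply: bary_single; rewrite supp_normalize.
have u := @supp_circle_upper k base ler01 (lexx 0).
have l := @supp_circle_lower k base ler01 (lexx 0).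
apply/fintype.subsetP => v kv; move/fintype.subsetP: u => /(_ v kv).
move/fintype.subsetP: l => /(_ v kv); rewrite !inE; case: v kv => [j|] //= _.
by rewrite !(inj_eq Some_inj) => /eqP->; rewrite eq_sym ord3_succ_neq.
Qed.

Lemma continuous_circle_to_wheel k : continuous (circle_to_wheel k).
Proof.
apply: continuous_normalize => v.
have cx := @continuous_circle_x R; have cy := @continuous_circle_y R.
have cm (f : C -> R) : continuous f -> continuous (fun c => Num.max 0 (f c)).
  by apply: continuous_max_all; exact: continuous_cst_all.
case: v => [j|] /=; last exact: cm.
by apply: continuousD_all; apply: continuousM_all;
  try exact: continuous_cst_all; apply: continuousD_all; apply: cm => //;
  exact: continuousN_all.
Qed.

Definition wedge_to_wheel : W -> Y := wedge_fun circle_to_wheel.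

Lemma wedge_to_wheel_lift k c :
  wedge_to_wheel (wedge_lift pt (i := k) c) = circle_to_wheel k c.
Proof.
by rewrite /wedge_to_wheel wedge_lift_funE // => i j; rewrite !circle_to_wheel_base.
Qed.

Lemma continuous_wedge_to_wheel : continuous wedge_to_wheel.
Proof.
apply: wedge_fun_continuous => [k|i j]; first exact: continuous_circle_to_wheel.
by rewrite !circle_to_wheel_base.
Qed.

End WheelWedge.

Section WheelWedgeEquivalence.
Variable R : realType.
Local Notation I := (unit_interval R).
Local Notation K := (complete_graph (option 'I_3)).
Local Notation Kcplx := (complete_graph_complex (option 'I_3)).
Local Notation Y := (polyhedron R K).
Local Notation vx := (vertex R Kcplx).
Local Notation C := (set_type (circle R)).
Local Notation base := (circle_base R).
Local Notation W := (circle_wedge R 3).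
Local Notation pt := (fun _ : 'I_3 => circle_base R).
Implicit Types (y : Y) (k : 'I_3) (c : C).

Lemma circle_to_wheel_supp k c (s : {set option 'I_3}) :
  supp (circle_weight k c) \subset s ->
  supp (bary (circle_to_wheel k c)) \subset s.
Proof. by rewrite supp_normalize. Qed.

Lemma rim_prod_right k c j : 0 <= circle_x c ->
  rim_prod (circle_to_wheel k c) j = 0.
Proof.
move=> x0; case/orP: (le_total 0 (circle_y c)) => y0.
  exact: rim_prod_spoke (circle_to_wheel_supp (supp_circle_upper k x0 y0)) j.
exact: rim_prod_spoke (circle_to_wheel_supp (supp_circle_lower k x0 y0)) j.
Qed.

Lemma rim_prod_other k c j : j != k -> rim_prod (circle_to_wheel k c) j = 0.
Proof.
move=> jk; case/orP: (le_total 0 (circle_x c)) => x0.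
  exact: rim_prod_right.
exact: rim_prod_rim (circle_to_wheel_supp (supp_circle_left k x0)) jk.
Qed.

Lemma wheel_to_wedge_circle k c :
  wheel_to_wedge (circle_to_wheel k c) =
  wedge_lift pt (i := k) (rim_circle (circle_to_wheel k c) k).
Proof.
apply: wheel_to_wedge_eq => // j jk.
by rewrite rim_circle_base // rim_prod_other.
Qed.

(** Going to the wheel and back moves no point of a circle to its antipode. *)
Lemma rim_circle_not_antipodal k c :
  (circle_x c + circle_x (rim_circle (circle_to_wheel k c) k) != 0) ||
  (circle_y c + circle_y (rim_circle (circle_to_wheel k c) k) != 0).
Proof.
set d := rim_circle _ _; have cE := circleE c.
have [x0|x0] := leP 0 (circle_x c).
  rewrite /d rim_circle_base ?rim_prod_right // base_x gt_eqF //.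
  by rewrite ltr_wpDl.
apply: contraT; rewrite negb_or !negbK => /andP[/eqP xd /eqP yd].
have sum1 : bary (circle_to_wheel k c) (Some k) +
    bary (circle_to_wheel k c) (Some (k + 1)) = 1.
  by apply: rim_sum; exact: (circle_to_wheel_supp (supp_circle_left k (ltW x0))).
have diff : exists2 r, 0 < r & bary (circle_to_wheel k c) (Some k) -
    bary (circle_to_wheel k c) (Some (k + 1)) = r * circle_y c.
  have S0 := weights_sum_gt0 Kcplx (circle_weightP k c).
  exists (\sum_v circle_weight k c v)^-1; first by rewrite invr_gt0.
  rewrite !bary_normalize circle_weight_k circle_weight_k1 -mulrBl mulrC.
  congr (_ * _); rewrite opprD addrACA subrr addr0.
  case/orP: (le_total 0 (circle_y c)) => y0.
    by rewrite max_r // max_l ?oppr_le0 // subr0.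
  by rewrite max_l // max_r ?oppr_ge0 // sub0r opprK.
have u0 := bary_ge0 (circle_to_wheel k c) (Some k).
have v0 := bary_ge0 (circle_to_wheel k c) (Some (k + 1)).
have n0 := modulus_gt0 (rim_curve_neq0 (circle_to_wheel k c) k).
move: xd yd; rewrite /d /rim_circle direction_x direction_y.
rewrite /rim_curve_x /rim_curve_y in n0 *; move: (modulus _ _) n0 => n n0.
case: diff => r r0 diff; rewrite /rim_prod.
move: (bary _ _) (bary _ _) sum1 diff u0 v0 => u v sum1 diff u0 v0.
move: (circle_x c) (circle_y c) x0 cE diff => x z x0 cE diff xd yd.
have n1 : 0 < n^-1 by rewrite invr_gt0.
have z0 : z = 0.
  have uvn : 0 <= u * v * r / n.
    by rewrite !mulr_ge0 // ?ltW.
  have : z * (1 + u * v * r / n) = 0 by rewrite -[RHS]yd diff; ring.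
  move/eqP; rewrite mulf_eq0 => /orP[/eqP //|].
  by rewrite gt_eqF // ltr_pwDl.
have u2 : u = 2^-1 by move: diff; rewrite z0 mulr0; lra.
have v2 : v = 2^-1 by lra.
move: xd; rewrite u2 v2 => xd; have : x + (1 - 6 * (2^-1 * 2^-1)) * n^-1 < 0.
  by nra.
by rewrite xd ltxx.
Qed.

(** On each circle the two maps are joined by segments, pushed away from the
    origin to the circle; the base point does not move, so these homotopies
    fit together on the wedge. *)
Lemma wedge_wheel_wedge : homotopic R (@wheel_to_wedge R \o @wedge_to_wheel R) idfun.
Proof.
apply: homotopic_sym.
pose phi k c := rim_circle (circle_to_wheel k c) k.
pose a k (tc : I * C) : R :=
  (1 - coord tc.1) * circle_x tc.2 + coord tc.1 * circle_x (phi k tc.2).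
pose b k (tc : I * C) : R :=
  (1 - coord tc.1) * circle_y tc.2 + coord tc.1 * circle_y (phi k tc.2).
have ab k tc : a k tc ^+ 2 + b k tc ^+ 2 != 0.
  by apply: circle_segment_neq0; exact: rim_circle_not_antipodal.
pose h k (t : I) (c : C) : W := wedge_lift pt (i := k) (direction (ab k (t, c))).
have ch k : continuous (uncurry (h k)).
  rewrite (_ : uncurry _ =
      fun tc => wedge_lift pt (i := k) (direction (ab k tc))); last first.
    by apply/funext => -[].
  apply: (@continuous_comp_all _ _ _ (fun tc => direction (ab k tc))
    (wedge_lift pt (i := k))).
    by move=> c; exact: (@wedge_lift_continuous _ _ pt k c).
  have ct : continuous (fun tc : I * C => coord tc.1).
    by apply: continuous_coord_comp; exact: continuous_fst_all.
  have ct' : continuous (fun tc : I * C => 1 - coord tc.1).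
    by apply: continuousB_all => //; exact: continuous_cst_all.
  have cphi : continuous (phi k).
    have cb v : continuous (fun c => bary (circle_to_wheel k c) v).
      apply: (@continuous_comp_all _ _ _ (circle_to_wheel k) (fun y => bary y v)).
        exact: continuous_bary.
      exact: continuous_circle_to_wheel.
    have cp : continuous (fun c => rim_prod (circle_to_wheel k c) k).
      exact: continuousM_all.
    apply: continuous_direction.
      apply: continuousB_all; first exact: continuous_cst_all.
      by apply: continuousM_all => //; exact: continuous_cst_all.
    by apply: continuousM_all => //; exact: continuousB_all.
  have csnd : continuous (@snd I C) by exact: continuous_snd_all.
  have cphi2 : continuous (fun tc : I * C => phi k tc.2).
    exact: (continuous_comp_all cphi csnd).
  have cx := @continuous_circle_x R; have cy := @continuous_circle_y R.
  apply: continuous_direction; apply: continuousD_all; apply: continuousM_all => //.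
  - exact: (continuous_comp_all cx csnd).
  - exact: (continuous_comp_all cx cphi2).
  - exact: (continuous_comp_all cy csnd).
  - exact: (continuous_comp_all cy cphi2).
have phi_base k : phi k base = base.
  by rewrite /phi rim_circle_base // rim_prod_right.
have h_base t k : h k t base = wedge_lift pt (i := k) base.
  congr wedge_lift; apply: direction_circle; rewrite /a /b /= phi_base;
  by rewrite -mulrDl subrK mul1r.
have hE t k l : h k t base = h l t base by rewrite !h_base; exact: (@wedge_liftE _ _ pt l base k base).
have cH := wedge_fun_joint_continuous ord3_finite (@pt_closed R) hE ch.
exists (fun wt : W * I => wedge_fun (fun k => h k wt.2) wt.1); split.
- apply: (@continuous_comp_all _ _ _ (fun wt : W * I => (wt.2, wt.1))
    (uncurry (fun t => wedge_fun (fun k => h k t)))); first exact: cH.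
  by apply: continuous_pair; [exact: continuous_snd_all|exact: continuous_fst_all].
- elim/wedge_ind => k c; rewrite /= wedge_lift_funE; last exact: hE.
  congr wedge_lift; apply: direction_circle;
  by rewrite /a /b /= coord0 mul0r subr0 mul1r addr0.
- elim/wedge_ind => k c; rewrite /= wedge_lift_funE; last exact: hE.
  rewrite wedge_to_wheel_lift wheel_to_wedge_circle.
  congr wedge_lift; apply: direction_circle;
  by rewrite /a /b /= coord1 mul1r subrr mul0r add0r.
Qed.

(** An intermediate map: it shrinks supports, and on the rim it already sends
    to a vertex all points that come back from the wedge on a spoke.  The
    threshold [2/9] lies below [1/4], so that not all weights vanish, and
    [2/9 * (1 - 2/9) > 1/6]. *)
Definition shrink_weight (y : Y) (v : option 'I_3) : R :=
  if v is Some k then Num.max 0 (bary y (Some k) - 2 / 9) else bary y None.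

Lemma supp_shrink_weight y : supp (shrink_weight y) \subset supp (bary y).
Proof.
apply/fintype.subsetP => v; rewrite !inE; apply: contraNN => /eqP yv.
by case: v yv => [k|] /= ->; rewrite ?max_l //; lra.
Qed.

Lemma shrink_weightP y : weights K (shrink_weight y).
Proof.
have w0 v : 0 <= shrink_weight y v.
  by case: v => [k|] /=; rewrite ?bary_ge0 // le_max lexx.
split=> //; have [_ Kdown _] := Kcplx.
apply: (Kdown _ _ (supp_bary y) (supp_shrink_weight y)).
apply/finset.set0Pn; exists (large_coordinate Kcplx y); rewrite inE.
have := large_coordinateP Kcplx y; rewrite /mesh card_option card_ord.
case: (large_coordinate _ _) => [k|] /= yk; last by rewrite gt_eqF; lra.
by rewrite gt_eqF // lt_max; apply/orP; right; lra.
Qed.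

Definition shrink (y : Y) : Y := normalize Kcplx (shrink_weightP y).

Lemma supp_shrink y : supp (bary (shrink y)) \subset supp (bary y).
Proof. by rewrite supp_normalize supp_shrink_weight. Qed.

Lemma continuous_shrink : continuous shrink.
Proof.
apply: continuous_normalize => -[k|] /=; last exact: continuous_bary.
apply: continuous_max_all; first exact: continuous_cst_all.
by apply: continuousB_all; [exact: continuous_bary | exact: continuous_cst_all].
Qed.

Lemma shrink_small y k : bary y (Some k) <= 2 / 9 ->
  Some k \notin supp (bary (shrink y)).
Proof.
by move=> yk; rewrite supp_normalize inE negbK /= max_l //; lra.
Qed.

Lemma supp_shrink_rim y k j : supp (bary y) \subset [set Some k; Some j]%SET ->
  bary y (Some j) <= 2 / 9 -> supp (bary (shrink y)) \subset [set Some k]%SET.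
Proof.
move=> ys yj; apply/fintype.subsetP => v vy; rewrite inE.
have := fintype.subsetP ys v (fintype.subsetP (supp_shrink y) v vy).
rewrite !inE => /orP[//|/eqP vj]; rewrite vj in vy.
by have := shrink_small yj; rewrite vy.
Qed.

(** A spoke shrinks into itself and comes back from the wedge as the hub.  A
    point of the rim that comes back on a spoke satisfies [6uv < 1]; then the
    smaller of its two coordinates [u] and [v] is below the threshold, and the
    point shrinks to the end of this spoke. *)
Lemma shrink_joined y : joined (shrink y) (wedge_to_wheel (wheel_to_wedge y)).
Proof.
case: (wheel_edgeP y) => k ys.
  have -> : wedge_to_wheel (wheel_to_wedge y) = vx None.
    rewrite (@wheel_to_wedge_eq _ _ ord0 base) ?wedge_to_wheel_lift.
    - exact: circle_to_wheel_base.
    - by move=> j _; rewrite rim_circle_base // (rim_prod_spoke ys).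
    - by rewrite rim_circle_base // (rim_prod_spoke ys).
  apply: (joined_simplex Kcplx (edge_complete_graph None (Some k))).
    exact: fintype.subset_trans (supp_shrink y) ys.
  by rewrite supp_vertex finset.sub1set !inE eqxx.
rewrite (@wheel_to_wedge_eq _ _ k (rim_circle y k)) //; last first.
  by move=> j jk; rewrite rim_circle_base // (rim_prod_rim ys).
rewrite wedge_to_wheel_lift; set c := rim_circle y k.
have sum1 := rim_sum ys.
have u0 := bary_ge0 y (Some k); have v0 := bary_ge0 y (Some (k + 1)).
have n0 := modulus_gt0 (rim_curve_neq0 y k).
have n1 : 0 < (modulus (rim_curve_x y k) (rim_curve_y y k))^-1.
  by rewrite invr_gt0.
have p0 : 0 <= rim_prod y k by rewrite mulr_ge0.
have [x0|x0] := leP (circle_x c) 0.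
  apply: (joined_simplex Kcplx (edge_complete_graph (Some k) (Some (k + 1)))).
    exact: fintype.subset_trans (supp_shrink y) ys.
  exact: circle_to_wheel_supp (supp_circle_left k x0).
have p6 : rim_prod y k < 6^-1.
  move: x0; rewrite direction_x pmulr_lgt0 // /rim_curve_x; lra.
case/orP: (le_total (bary y (Some (k + 1))) (bary y (Some k))) => uv.
  apply: (joined_simplex Kcplx (edge_complete_graph None (Some k))).
    apply: fintype.subset_trans (supp_shrink_rim ys _) _.
      by move: p6; rewrite /rim_prod; nra.
    by rewrite finset.sub1set !inE eqxx orbT.
  apply: circle_to_wheel_supp (supp_circle_upper k (ltW x0) _).
  by rewrite direction_y pmulr_lge0 // mulr_ge0 // subr_ge0.
apply: (joined_simplex Kcplx (edge_complete_graph None (Some (k + 1)))).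
  rewrite finset.setUC in ys.
  apply: fintype.subset_trans (supp_shrink_rim ys _) _.
    by move: p6; rewrite /rim_prod; nra.
  by rewrite finset.sub1set !inE eqxx orbT.
apply: circle_to_wheel_supp (supp_circle_lower k (ltW x0) _).
by rewrite direction_y pmulr_lle0 // mulr_ge0_le0 // subr_le0.
Qed.

Lemma wheel_wedge_wheel : homotopic R (@wedge_to_wheel R \o @wheel_to_wedge R) idfun.
Proof.
have cf := @continuous_wheel_to_wedge R; have cg := @continuous_wedge_to_wheel R.
apply: (@homotopic_trans _ _ _ _ shrink).
  apply: homotopic_sym; apply: (straight_homotopic Kcplx continuous_shrink) => [|y].
    exact: continuous_comp_all.
  exact: shrink_joined.
apply: (straight_homotopic Kcplx continuous_shrink) => [|y].
  exact: continuous_id_all.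
exact: (joined_simplex Kcplx (supp_bary y) (supp_shrink y)).
Qed.

Theorem wheel_wedge_equivalent : homotopy_equivalent R Y W.
Proof.
exists (@wheel_to_wedge R), (@wedge_to_wheel R); split.
- exact: continuous_wheel_to_wedge.
- exact: continuous_wedge_to_wheel.
- exact: wheel_wedge_wheel.
- exact: wedge_wheel_wedge.
Qed.

End WheelWedgeEquivalence.

(** * Order complexes over a complete graph *)

Lemma order_complex_complex d (P : finPOrderType d) :
  is_complex (order_complex P).
Proof.
split=> [|s s'|v]; rewrite !inE ?eqxx //.
  move=> /andP[_ /forall_inP sc] /fintype.subsetP s's ->; apply/forall_inP => x xs.
  by apply/forall_inP => y ys; apply: (forall_inP (sc x _)); exact: s's.
apply/andP; split; first by apply/finset.set0Pn; exists v; rewrite inE.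
apply/forall_inP => x /finset.set1P->; apply/forall_inP => y /finset.set1P->.
exact: comparablexx.
Qed.

Lemma order_complex_comparable d (P : finPOrderType d) (s : {set P}) x y :
  s \in order_complex P -> x \in s -> y \in s -> (x >=< y)%O.
Proof. by rewrite inE => /andP[_ /forall_inP sc] xs; exact/forall_inP/sc. Qed.

(** An element of a chain with the most elements of the poset below it. *)
Lemma order_complex_top d (P : finPOrderType d) (s : {set P}) :
  s \in order_complex P -> exists2 c, c \in s & forall x, x \in s -> (x <= c)%O.
Proof.
move=> sK; have /finset.set0Pn[c0 c0s] : s != finset.set0.
  by move: sK; rewrite inE => /andP[].
case: (@arg_maxnP _ c0 (mem s) (fun c => #|[set x | x <= c]%O%SET|) c0s) => c cs cmax.
exists c => // x xs; have := order_complex_comparable sK xs cs.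
case/orP => // cx; have /= := cmax x xs; rewrite leqNgt => /negP h.
have [->//|xc] := eqVneq x c; case: h; apply: proper_card.
apply/properP; split.
  by apply/fintype.subsetP => y; rewrite !inE => /le_trans; apply.
exists x; rewrite !inE ?lexx //; apply/negP => xc'.
by move: xc; rewrite eq_le xc' cx.
Qed.

(** Here [c |-> G (F c)] is a closure operator on [P] whose closed elements are
    indexed by the simplices of the complete graph.  If moreover adding the
    closures of its elements to a chain leaves it a chain, the straight-line
    homotopy contracts the order complex onto that of the closed elements. *)
Section PosetOverGraph.
Variables (R : realType) (d : Order.disp_t) (P : finPOrderType d) (V : finType).
Local Notation KP := (order_complex P).
Local Notation KPcplx := (order_complex_complex P).
Local Notation K := (complete_graph V).
Local Notation Kcplx := (complete_graph_complex V).
Local Notation X := (polyhedron R KP).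
Local Notation Y := (polyhedron R K).
Implicit Types (x : X) (y : Y) (c : P) (s : {set V}) (v : V).

Variables (F : P -> {set V}) (G : {set V} -> P).
Hypothesis FK : forall c, F c \in K.
Hypothesis F_mono : forall c c', (c <= c')%O -> F c \subset F c'.
Hypothesis G_mono : forall s s', s \in K -> s' \in K -> s \subset s' ->
  (G s <= G s')%O.
Hypothesis GK : forall s, s \in K -> F (G s) = s.
Hypothesis le_GF : forall c, (c <= G (F c))%O.
Hypothesis GF_comparable : forall c c', (c <= c')%O -> (G (F c) >=< c')%O.

Lemma complete_graph_sub s s' : s \in K -> s' \in K -> s \subset s' ->
  #|s| != 1%N -> s = s'.
Proof.
rewrite !inE => /andP[s0 s2] /andP[s'0 s'2] ss' s1; apply/eqP.
by rewrite eqEcard ss' (leq_trans s'2) // ltn_neqAle eq_sym s1.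
Qed.

Definition poset_weight (x : X) (v : V) : R :=
  \sum_c bary x c * (v \in F c)%:R.

Lemma poset_weight_ge0 x v : 0 <= poset_weight x v.
Proof. by apply: sumr_ge0 => c _; rewrite mulr_ge0 ?bary_ge0 ?ler0n. Qed.

Lemma supp_poset_weightP x v : reflect
  (exists2 c, c \in supp (bary x) & v \in F c) (v \in supp (poset_weight x)).
Proof.
rewrite inE; apply: (iffP idP) => [xv|[c cx vc]].
  have [c cP] : exists c, bary x c * (v \in F c)%:R != 0.
    apply: contrapT => /forallNP none; case/negP: xv.
    by rewrite /poset_weight big1 // => c _; apply/eqP; apply: contraT => /none.
  move: cP; rewrite mulf_eq0 negb_or => /andP[cx vc]; exists c; rewrite ?inE //.
  by move: vc; rewrite pnatr_eq0 eqb0 negbK.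
rewrite gt_eqF // /poset_weight (bigD1 c) //= vc mulr1.
apply: ltr_pwDl; first by rewrite lt_def bary_ge0 andbT; rewrite inE in cx.
by apply: sumr_ge0 => c' _; rewrite mulr_ge0 ?bary_ge0 ?ler0n.
Qed.

Lemma supp_poset_weight_top x : exists2 c, c \in supp (bary x) &
  supp (poset_weight x) \subset F c.
Proof.
have [c cx ctop] := order_complex_top (supp_bary x); exists c => //.
apply/fintype.subsetP => v /supp_poset_weightP[c' c'x].
by apply/fintype.subsetP/F_mono/ctop.
Qed.

Lemma poset_weightP x : weights K (poset_weight x).
Proof.
split; first exact: poset_weight_ge0.
have [c cx sub] := supp_poset_weight_top x.
have [_ Kdown _] := Kcplx; apply: (Kdown _ _ (FK c) sub).
have := FK c; rewrite inE card_gt0 => /andP[/finset.set0Pn[v vc] _].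
by apply/finset.set0Pn; exists v; apply/supp_poset_weightP; exists c.
Qed.

Definition poset_to_graph (x : X) : Y := normalize Kcplx (poset_weightP x).

Lemma continuous_poset_to_graph : continuous poset_to_graph.
Proof.
apply: continuous_normalize => v; apply: continuous_sum_all => c.
apply: continuousM_all; first exact: continuous_bary.
exact: continuous_cst_all.
Qed.

(** Barycentric subdivision of a graph, up to normalization: a vertex gets a
    positive weight at the points where its coordinate dominates, an edge at
    its interior points. *)
Definition simplex_weight (y : Y) (s : {set V}) : R :=
  if #|s| == 1%N then Num.max 0 (2 * (\sum_(v in s) bary y v) - 1)
  else \prod_(v in s) bary y v.

Definition graph_weight (y : Y) (c : P) : R :=
  if c == G (F c) then simplex_weight y (F c) else 0.

Lemma simplex_weight_ge0 y s : 0 <= simplex_weight y s.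
Proof.
rewrite /simplex_weight; case: ifP => _; first by rewrite le_max lexx.
by apply: prodr_ge0 => v _; exact: bary_ge0.
Qed.

Lemma simplex_weight_neq0 y s : simplex_weight y s != 0 -> s \subset supp (bary y).
Proof.
rewrite /simplex_weight; case: ifP => [/cards1P[v ->]|_].
  rewrite finset.sub1set inE big_set1; apply: contraNneq => ->.
  by rewrite mulr0 max_l //; lra.
move=> s0; apply/fintype.subsetP => v vs; rewrite inE; apply: contraNneq s0 => yv.
by rewrite (bigD1 v) //= yv mul0r.
Qed.

Lemma simplex_weight1_eq y v w : simplex_weight y [set v]%SET != 0 ->
  simplex_weight y [set w]%SET != 0 -> v = w.
Proof.
rewrite /simplex_weight !cards1 eqxx !big_set1 => yv yw.
apply: contraNeq yv => vw.
have : bary y v + bary y w <= 1.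
  rewrite -(bary_sum y) (bigD1 v) //= (bigD1 w) 1?eq_sym //= addrA lerDl.
  by apply: sumr_ge0 => u _; exact: bary_ge0.
have : 0 < 2 * bary y w - 1.
  by rewrite ltNge; apply: contraNN yw => yw; rewrite max_l.
by move=> ? ?; rewrite max_l //; lra.
Qed.

Lemma simplex_weight_comparable y s s' : s \in K -> s' \in K ->
  simplex_weight y s != 0 -> simplex_weight y s' != 0 ->
  (s \subset s') || (s' \subset s).
Proof.
move=> sK s'K ys ys'.
have yK := supp_bary y; have sy := simplex_weight_neq0 ys.
have s'y := simplex_weight_neq0 ys'.
have [s1|s1] := eqVneq #|s| 1%N; last first.
  by rewrite (complete_graph_sub sK yK sy s1) s'y orbT.
have [s'1|s'1] := eqVneq #|s'| 1%N; last first.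
  by rewrite (complete_graph_sub s'K yK s'y s'1) sy.
move/eqP/cards1P: s1 ys => [v ->] yv; move/eqP/cards1P: s'1 ys' => [w ->] yw.
by rewrite (simplex_weight1_eq yv yw) fintype.subxx.
Qed.

Lemma simplex_weight_supp y : simplex_weight y (supp (bary y)) != 0.
Proof.
rewrite /simplex_weight; case: ifP => [/cards1P[v vE]|_].
  rewrite vE big_set1; suff -> : bary y v = 1 by rewrite gt_eqF // lt_max; lra.
  rewrite -(bary_sum y) (bigD1 v) //= big1 ?addr0 // => u uv.
  by apply/eqP; apply: contraNT uv => yu; rewrite -finset.in_set1 -vE inE.
by apply/prodf_neq0 => v; rewrite inE.
Qed.

Lemma supp_graph_weightP y c : c \in supp (graph_weight y) ->
  c = G (F c) /\ simplex_weight y (F c) != 0.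
Proof. by rewrite inE /graph_weight; case: (c =P G (F c)) => // _; rewrite eqxx. Qed.

Lemma graph_weightP y : weights KP (graph_weight y).
Proof.
split.
  by move=> c; rewrite /graph_weight; case: ifP => // _; exact: simplex_weight_ge0.
rewrite inE; apply/andP; split.
  apply/finset.set0Pn; exists (G (supp (bary y))).
  by rewrite inE /graph_weight GK ?supp_bary // eqxx simplex_weight_supp.
apply/forall_inP => c /supp_graph_weightP[cE yc].
apply/forall_inP => c' /supp_graph_weightP[c'E yc'].
rewrite cE c'E.
apply/orP; case/orP: (simplex_weight_comparable (FK c) (FK c') yc yc') => sub;
  [left | right]; exact: G_mono.
Qed.

Definition graph_to_poset (y : Y) : X := normalize KPcplx (graph_weightP y).

Lemma continuous_graph_to_poset : continuous graph_to_poset.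
Proof.
apply: continuous_normalize => c; rewrite /graph_weight.
case: (c =P G (F c)) => _; last exact: continuous_cst_all.
rewrite /simplex_weight; case: (#|F c| == 1%N).
  apply: continuous_max_all; first exact: continuous_cst_all.
  apply: continuousB_all; last exact: continuous_cst_all.
  apply: continuousM_all; first exact: continuous_cst_all.
  by apply: continuous_sum_all => v; exact: continuous_bary.
by apply: continuous_prod_all => v; exact: continuous_bary.
Qed.

Lemma graph_poset_graph : homotopic R (poset_to_graph \o graph_to_poset) idfun.
Proof.
apply: (straight_homotopic Kcplx) => [||y].
- apply: continuous_comp_all; first exact: continuous_poset_to_graph.
  exact: continuous_graph_to_poset.
- exact: continuous_id_all.
apply: (joined_simplex Kcplx (supp_bary y)) => //.
rewrite supp_normalize; apply/fintype.subsetP => v /supp_poset_weightP[c].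
rewrite supp_normalize => /supp_graph_weightP[_ /simplex_weight_neq0 cy].
exact: (fintype.subsetP cy).
Qed.

(** Only the simplices [F c] of elements [c] of the chain carrying [x] get a
    positive weight. *)
Lemma supp_poset_graph_poset x c :
  c \in supp (bary (graph_to_poset (poset_to_graph x))) ->
  exists2 c', c' \in supp (bary x) & c = G (F c').
Proof.
rewrite supp_normalize => /supp_graph_weightP[cE xc].
have [top topx] := supp_poset_weight_top x.
have := simplex_weight_neq0 xc; rewrite supp_normalize => cx xtop.
have [c1|c1] := eqVneq #|F c| 1%N; last first.
  exists top => //; rewrite cE; congr G.
  exact: complete_graph_sub (FK c) (FK top) (fintype.subset_trans cx xtop) c1.
move/eqP/cards1P: c1 => [v vE]; move: xc; rewrite vE /simplex_weight cards1 eqxx.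
rewrite big_set1 bary_normalize => xv.
have S0 := weights_sum_gt0 Kcplx (poset_weightP x).
have {xv} : 0 < 2 * poset_weight x v - \sum_w poset_weight x w.
  rewrite ltNge; apply: contraNN xv => xv; rewrite max_l //.
  by rewrite subr_le0 mulrA ler_pdivrMr // mul1r -subr_le0.
have -> : 2 * poset_weight x v - \sum_w poset_weight x w =
    \sum_c' bary x c' * (2 * (v \in F c')%:R - #|F c'|%:R).
  rewrite /poset_weight exchange_big /= mulr_sumr -sumrB; apply: eq_bigr => c' _.
  rewrite -mulr_sumr mulrBr mulrCA; congr (_ - _ * _).
  rewrite -sum1_card natr_sum [RHS]big_mkcond /=.
  by apply: eq_bigr => w _; case: ifP.
move=> pos; have [c' c'P] : exists c', 0 < bary x c' * (2 * (v \in F c')%:R - #|F c'|%:R).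
  apply: contrapT => /forallNP none; move: pos; rewrite ltNge; case/negP.
  by apply: sumr_le0 => c' _; rewrite leNgt; apply/negP/none.
exists c'.
  by rewrite inE; apply: contraTneq c'P => ->; rewrite mul0r ltxx.
rewrite cE vE; congr G; apply/eqP.
have : 0 < 2 * (v \in F c')%:R - #|F c'|%:R :> R.
  by move: c'P; rewrite lt0r; have := bary_ge0 x c'; nra.
have := FK c'; rewrite inE => /andP[c'0 c'2].
rewrite subr_gt0 -natrM ltr_nat; case vc': (v \in F c'); rewrite ?muln0 // muln1.
move=> c'1; rewrite eqEcard finset.sub1set vc' cards1 -ltnS.
exact: c'1.
Qed.

Lemma poset_graph_poset : homotopic R (graph_to_poset \o poset_to_graph) idfun.
Proof.
apply: homotopic_sym; apply: (straight_homotopic KPcplx) => [||x].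
- exact: continuous_id_all.
- apply: continuous_comp_all; first exact: continuous_graph_to_poset.
  exact: continuous_poset_to_graph.
have comp c c' : c \in supp (bary x) -> c' \in supp (bary x) ->
    (G (F c) >=< c')%O.
  move=> cx c'x; have /orP[cc'|c'c] := order_complex_comparable (supp_bary x) cx c'x.
    exact: GF_comparable.
  by apply/orP; right; exact: le_trans c'c (le_GF c).
pose s := (supp (bary x) :|: [set G (F c) | c in supp (bary x)])%SET.
have sK : s \in KP.
  rewrite inE; apply/andP; split.
    have := supp_bary x; rewrite inE => /andP[/finset.set0Pn[c cx] _].
    by apply/finset.set0Pn; exists c; rewrite inE cx.
  apply/forall_inP => c1 /finset.setUP[c1x|/imsetP[c c1x ->]];
  apply/forall_inP => c2 /finset.setUP[c2x|/imsetP[c' c2x ->]].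
  - exact: order_complex_comparable (supp_bary x) c1x c2x.
  - by rewrite comparable_sym comp.
  - exact: comp.
  - have /orP[cc'|cc'] := order_complex_comparable (supp_bary x) c1x c2x;
      apply/orP; [left | right]; apply: G_mono => //; exact: F_mono.
apply: (joined_simplex KPcplx sK).
  exact: finset.subsetUl.
apply/fintype.subsetP => c /supp_poset_graph_poset[c' c'x ->].
by rewrite inE; apply/orP; right; exact: imset_f.
Qed.

Theorem poset_graph_equivalent : homotopy_equivalent R X Y.
Proof.
exists poset_to_graph, graph_to_poset; split.
- exact: continuous_poset_to_graph.
- exact: continuous_graph_to_poset.
- exact: poset_graph_poset.
- exact: graph_poset_graph.
Qed.

End PosetOverGraph.

(** * The subgroups of the quaternion group *)

Section Quaternion8.
Local Open Scope group_scope.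
Local Open Scope nat_scope.
Local Notation gT := (quaternion_gtype 8).
Local Notation Q := ('Q_8)%G.
Local Notation Z := ('Z(Q))%G.
Implicit Types (H : {group gT}) (x y w : gT).

Lemma card_Q8 : #|Q| = 8. Proof. exact: (@card_quaternion 3). Qed.

Lemma Q8_center : #|Z| = 2 /\ forall x, #[x] = 2 -> x \in Z.
Proof.
have isoQ : Q \isog 'Q_(2 ^ 3) by exact: isog_refl.
have [[a b] genQ _] := generators_quaternion (isT : 2 < 3) isoQ.
have [_ _ [ZE oZ involution _ _] _ _] :=
  quaternion_structure (isT : 2 < 3) genQ isoQ.
split=> // x ox; rewrite /= ZE (involution x) ?cycle_id //; exact: finset.in_setT.
Qed.

Lemma subQ8 (A : {set gT}) : A \subset Q. Proof. exact: finset.subsetT. Qed.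

Lemma card_subgroup_Q8 H : #|H| %| 2 ^ 3.
Proof. by rewrite -[2 ^ 3]card_Q8 cardSg ?subQ8. Qed.

(** The centre is generated by the only involution, so every nontrivial
    subgroup contains it. *)
Lemma center_sub_Q8 H : H :!=: 1%g -> Z \subset H.
Proof.
move=> H1; have [oZ involution] := Q8_center.
have H2 : 2 %| #|H|.
  have /dvdn_pfactor := card_subgroup_Q8 H.
  case=> // -[|n] _ oH; last by rewrite oH expnS dvdn_mulr.
  by case/negP: H1; rewrite trivg_card1 oH.
have [x xH ox] := Cauchy (isT : prime 2) H2.
have xZ := involution x ox.
suff -> : Z :=: <[x]> by rewrite cycle_subG.
by apply/esym/eqP; rewrite eqEcard cycle_subG xZ -orderE ox oZ.
Qed.

Lemma center_cosets_card w : w \notin Z -> #|(Z :|: w *: Z)%SET| = 4.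
Proof.
have [oZ _] := Q8_center => wZ; rewrite cardsU card_lcoset oZ.
suff -> : (Z :&: w *: Z)%SET = finset.set0 by rewrite cards0.
apply/setP => x; rewrite finset.in_setI finset.in_set0; apply/negP => /andP[xZ].
case/lcosetP => z zZ xE; case/negP: wZ.
by rewrite -(mulgK z w) -xE groupM ?groupV.
Qed.

(** By the orders 2 and 4 there is no room for a third coset of the centre in
    a proper subgroup. *)
Lemma subgroup_Q8_eq H w : H \proper Q -> w \in H -> w \notin Z ->
  H :=: (Z :|: w *: Z)%SET.
Proof.
move=> HQ wH wZ; have H1 : H :!=: 1%g.
  by apply: contraNneq wZ => H1; move: wH; rewrite H1 => /set1gP->; exact: group1.
have ZH := center_sub_Q8 H1.
apply/esym/eqP; rewrite eqEcard (center_cosets_card wZ) finset.subUset ZH /=.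
rewrite mul_subG ?finset.sub1set //=.
have /dvdn_pfactor := card_subgroup_Q8 H; case=> // n n3 oH.
have := proper_card HQ; rewrite card_Q8 oH.
by case: n n3 {oH} => [|[|[|[|]]]].
Qed.

Lemma proper_subgroup_Q8 H : H \proper Q ->
  exists w, H \subset (Z :|: w *: Z)%SET.
Proof.
move=> HQ; have [HZ|/subsetPn[w wH wZ]] := boolP (H \subset Z).
  by exists 1%g; rewrite (fintype.subset_trans HZ) ?finset.subsetUl.
by exists w; rewrite -(subgroup_Q8_eq HQ wH wZ).
Qed.

Lemma center_proper_Q8 : Z \proper Q.
Proof.
by rewrite properEcard subQ8; have [-> _] := Q8_center; rewrite card_Q8.
Qed.

Lemma cycle_Q8 w : w \notin Z -> <[w]> \proper Q.
Proof.
move=> wZ; rewrite properEcard subQ8 ltn_neqAle subset_leq_card ?subQ8 // andbT.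
apply/negP => /eqP wQ; have QE : <[w]> :=: Q.
  by apply/eqP; rewrite eqEcard subQ8 wQ leqnn.
case/negP: wZ => /=; have /center_idP -> : abelian Q by rewrite -QE cycle_abelian.
exact: finset.in_setT.
Qed.

(** * The coset poset of the quaternion group *)

(** A numbering of the four cosets of the centre by the vertices of the
    wheel. *)
Definition center_index (x : gT) : option 'I_3 :=
  nth None (enum {: option 'I_3}) (index (x *: Z) (enum (lcosets Z Q))).

Lemma size_center_cosets :
  size (enum (lcosets Z Q)) = size (enum {: option 'I_3}).
Proof.
rewrite -!cardE card_option card_ord.
have -> : #|lcosets Z Q| = #|Q : Z| by rewrite card_lcosets.
by rewrite -divgS ?subQ8 // card_Q8; have [-> _] := Q8_center.
Qed.

Lemma center_coset_enum x : x *: Z \in enum (lcosets Z Q).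
Proof. by rewrite mem_enum; apply/lcosetsP; exists x; rewrite ?finset.in_setT. Qed.

Lemma center_indexE x y :
  (center_index x == center_index y) = (x *: Z == y *: Z).
Proof.
have lt u : index (u *: Z) (enum (lcosets Z Q)) < size (enum {: option 'I_3}).
  by rewrite -size_center_cosets index_mem center_coset_enum.
rewrite /center_index nth_uniq ?enum_uniq //.
apply/eqP/eqP => [xy|-> //].
by rewrite -(nth_index finset.set0 (center_coset_enum x)) xy nth_index //
  center_coset_enum.
Qed.

Lemma center_index_surj i : exists x, center_index x = i.
Proof.
have lt : index i (enum {: option 'I_3}) < size (enum (lcosets Z Q)).
  by rewrite size_center_cosets index_mem mem_enum.
have := mem_nth finset.set0 lt; rewrite mem_enum => /lcosetsP[x _ xE].
exists x; rewrite /center_index -xE index_uniq ?enum_uniq //.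
by rewrite nth_index // mem_enum.
Qed.

Lemma center_index_mul x z : z \in Z -> center_index (x * z) = center_index x.
Proof.
by move=> zZ; apply/eqP; rewrite center_indexE lcosetM lcoset_id.
Qed.

Local Notation P := (coset_poset Q).
Local Notation K := (complete_graph (option 'I_3)).
Implicit Types (c : P) (s : {set option 'I_3}).

Lemma coset_posetP c : exists H x, H \proper Q /\ coset_poset_val c = x *: H.
Proof.
have /existsP[H /andP[HQ /lcosetsP[x _ xE]]] := coset_poset_valP c.
by exists H, x; rewrite xE.
Qed.

Lemma proper_cosetP H x : H \proper Q -> is_proper_coset Q (x *: H).
Proof.
move=> HQ; apply/existsP; exists H; rewrite HQ /=.
by apply/lcosetsP; exists x; rewrite ?finset.in_setT.
Qed.

Definition index_set c : {set option 'I_3} :=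
  [set center_index x | x in coset_poset_val c]%SET.

Lemma index_set_graph c : index_set c \in K.
Proof.
have [H [x [HQ cE]]] := coset_posetP c.
have [w Hw] := proper_subgroup_Q8 HQ.
have [_ Kdown _] := complete_graph_complex (option 'I_3).
apply: (Kdown _ _ (edge_complete_graph (center_index x) (center_index (x * w)))).
  apply/fintype.subsetP => i /imsetP[u]; rewrite cE => /lcosetP[h hH ->] ->.
  have := fintype.subsetP Hw h hH; rewrite finset.in_setU => /orP[hZ|/lcosetP[z zZ ->]].
    by rewrite (center_index_mul _ hZ) finset.set21.
  by rewrite mulgA (center_index_mul _ zZ) finset.set22.
apply/finset.set0Pn; exists (center_index x); apply: imset_f.
by rewrite cE lcoset_refl.
Qed.

Lemma index_set_mono c c' : (c <= c')%O -> index_set c \subset index_set c'.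
Proof. by rewrite coset_poset_leE => cc'; exact: imsetS. Qed.

Definition index_preim s : {set gT} := [set x | center_index x \in s]%SET.

(** Two distinct cosets [x *: Z] and [y *: Z] form a coset of the cyclic group
    of order four generated by [x^-1 * y]. *)
Lemma index_preim_proper s : s \in K -> is_proper_coset Q (index_preim s).
Proof.
rewrite inE => /andP[s0 s2].
have [s1|s1] := eqVneq #|s| 1.
  move/eqP/cards1P: s1 => [i ->]; have [x xi] := center_index_surj i.
  have -> : index_preim [set i]%SET = x *: Z.
    apply/setP => u; rewrite inE finset.in_set1 -xi center_indexE.
    apply/eqP/idP => [<-|]; first exact: lcoset_refl.
    by move/lcoset_eqP.
  exact: proper_cosetP center_proper_Q8.
have /cards2P[i [j [ij ->]]] : #|s| == 2.
  by rewrite eqn_leq s2 ltn_neqAle eq_sym s1.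
have [x xi] := center_index_surj i; have [y yj] := center_index_surj j.
pose w := (x^-1 * y)%g.
have wZ : w \notin Z.
  apply: contra ij => wZ; rewrite -xi -yj -[y](mulKVg x) -/w eq_sym.
  by rewrite center_index_mul.
have -> : index_preim [set i; j]%SET = x *: <[w]>.
  rewrite (subgroup_Q8_eq (cycle_Q8 wZ) (cycle_id w) wZ).
  apply/setP => u; rewrite !inE -xi -yj !center_indexE mem_lcoset finset.in_setU.
  rewrite -mem_lcoset; congr (_ || _).
    apply/eqP/idP => [<-|]; first exact: lcoset_refl.
    by move/lcoset_eqP.
  rewrite mem_lcoset /w invMg invgK mulgA mulgK -mem_lcoset.
  apply/eqP/idP => [<-|]; first exact: lcoset_refl.
  by move/lcoset_eqP.
exact: proper_cosetP (cycle_Q8 wZ).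
Qed.

Definition hub_coset : P :=
  CosetPoset (index_preim_proper (edge_complete_graph None None)).

Definition index_coset s : P := insubd hub_coset (index_preim s).

Lemma index_cosetE s : s \in K -> coset_poset_val (index_coset s) = index_preim s.
Proof. by move=> sK; rewrite [LHS]val_insubd index_preim_proper. Qed.

Lemma index_coset_mono s s' : s \in K -> s' \in K -> s \subset s' ->
  (index_coset s <= index_coset s')%O.
Proof.
move=> sK s'K /fintype.subsetP ss'; rewrite coset_poset_leE !index_cosetE //.
by apply/fintype.subsetP => x; rewrite !inE => /ss'.
Qed.

Lemma index_cosetK s : s \in K -> index_set (index_coset s) = s.
Proof.
move=> sK; rewrite /index_set index_cosetE //; apply/setP => i.
apply/imsetP/idP => [[x + ->]|si]; first by rewrite inE.
by have [x xi] := center_index_surj i; exists x; rewrite ?inE ?xi.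
Qed.

Lemma le_index_coset c : (c <= index_coset (index_set c))%O.
Proof.
rewrite coset_poset_leE index_cosetE ?index_set_graph //.
by apply/fintype.subsetP => x xc; rewrite inE; exact: imset_f.
Qed.

(** A coset of a nontrivial subgroup is a union of cosets of the centre, and a
    singleton contains no other coset. *)
Lemma index_coset_comparable c c' : (c <= c')%O ->
  (index_coset (index_set c) >=< c')%O.
Proof.
have [H [x [HQ c'E]]] := coset_posetP c'.
have [H1|H1] := eqVneq (H : {set gT}) 1%g => cc'.
  have -> : c = c'.
    have [H' [y [_ cE]]] := coset_posetP c.
    have yc : y \in coset_poset_val c by rewrite cE lcoset_refl.
    apply: val_inj => /=; apply/eqP; rewrite finset.eqEsubset -coset_poset_leE cc'.
    move: cc' yc; rewrite coset_poset_leE c'E H1 mulg1.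
    move=> cx yc; rewrite finset.sub1set; have := fintype.subsetP cx y yc.
    by rewrite inE => /eqP <-.
  by apply/orP; right; exact: le_index_coset.
apply/orP; left; rewrite coset_poset_leE index_cosetE ?index_set_graph //.
apply/fintype.subsetP => u; rewrite inE => /imsetP[v vc /eqP].
rewrite center_indexE => /eqP uv; have u_vZ : u \in v *: Z.
  by rewrite -uv lcoset_refl.
have vxH : v \in x *: H.
  by rewrite -c'E; move: cc'; rewrite coset_poset_leE => /fintype.subsetP; apply.
case/lcosetP: u_vZ => z zZ ->; case/lcosetP: vxH => h hH ->.
rewrite c'E -mulgA mem_lcoset mulKg groupM //.
exact: (fintype.subsetP (center_sub_Q8 H1)).
Qed.

Theorem coset_poset_Q8_equivalent (R : realType) :
  homotopy_equivalent R (polyhedron R (order_complex P)) (polyhedron R K).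
Proof.
apply: (@poset_graph_equivalent R _ P _ index_set index_coset).
- exact: index_set_graph.
- exact: index_set_mono.
- exact: index_coset_mono.
- exact: index_cosetK.
- exact: le_index_coset.
- exact: index_coset_comparable.
Qed.

End Quaternion8.

Theorem claim4p1p4 (R : realType) :
  homotopy_equivalent R (poset_space R (coset_poset 'Q_8%G))
    (circle_wedge R 3) /\
  forall x : poset_space R (coset_poset 'Q_8%G),
    group_isomorphic (pi1 R x) (free_group 'I_3).
Proof.
have XY := coset_poset_Q8_equivalent R; split.
  exact: homotopy_equivalent_trans XY (wheel_wedge_equivalent R).
move=> x; have [f [g [cf cg gf fg]]] := XY.
apply: (group_isomorphic_trans (pi1_homotopy_equivalence cf cg gf fg x)).
have [p _] := wheel_connected (f x).
apply: group_isomorphic_trans (pi1_wheel R).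
exact: (pi1_basepoint (reverse p)).
Qed.
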